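(* Let $d$ be a positive integer, let $W_1,\dots,W_d$ be finite-dimensional complex vector spaces, each of dimension at least two, and let $r$ be a positive integer not more than the complex generic tensor rank of $W_1\otimes\cdots\otimes W_d$. Then the set of border rank-$r$ complex tensors $$\{A\in W_1\otimes\cdots\otimes W_d : \overline{\operatorname{rank}}(A)=r\}$$ is path-connected.
   Context: All topological statements use the Euclidean topology. For $A\in W_1\otimes\cdots\otimes W_d$ (complex vector spaces), $\operatorname{rank}(A)$ is the least $r\in\{0,1,2,\dots\}$ such that $A=\sum_{i=1}^r v_{1,i}\otimes\cdots\otimes v_{d,i}$ with $v_{j,i}\in W_j$. The border rank $\overline{\operatorname{rank}}(A)$ is the least $r$ such that $A$ lies in the (Euclidean) closure of $\{B\in W_1\otimes\cdots\otimes W_d : \operatorname{rank}(B)\le r\}$. The complex generic tensor rank is the smallest $r$ such that the closure of $\{B : \operatorname{rank}(B)\le r\}$ is all of $W_1\otimes\cdots\otimes W_d$. *)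

(* Defs.v *)
From HB Require Import structures.
From mathcomp Require Import all_boot all_order all_algebra.
From mathcomp Require Import complex.
From mathcomp Require Import all_classical all_reals all_analysis.

Set Implicit Arguments.
Unset Strict Implicit.
Unset Printing Implicit Defensive.

Import Order.TTheory GRing.Theory Num.Theory.
Import numFieldNormedType.Exports.
Local Open Scope classical_set_scope.
Local Open Scope ring_scope.
Local Open Scope complex_scope.

(* The value 0 on the empty set is junk; see tensor_rank_spec,
   border_rank_spec and generic_rank_spec. *)
Definition least (S : set nat) : nat := xget 0%N (S `&` lbound S).

Definition path_connected (R : realType) (X : topologicalType) (A : set X) :=
  forall x y : X, A x -> A y ->
    exists g : R -> X,
      [/\ {within `[0, 1]%classic, continuous g}, g 0 = x, g 1 = y
        & forall t : R, 0 <= t <= 1 -> A (g t)].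

(* The Euclidean topology of a finite-dimensional complex vector space, pulled
   back from C^n along the coordinate isomorphism v2r : T -> C^n (it does not depend on
   the choice of this isomorphism).  The alias ^o gives R[i] the topology of
   its modulus. *)
Definition euclidean (R : realType) (T : vectType R[i]) : topologicalType :=
  initial_topology (VectorInternalTheory.v2r : T -> 'rV[R[i]^o]_(dim T)).

Definition multilinear (K : fieldType) (d : nat) (W : 'I_d -> vectType K)
    (U : vectType K) (f : (forall i, W i) -> U) :=
  forall (v : forall i, W i) (i : 'I_d), linear (fun x : W i => f (eqtype.dfwith v x)).

(* (T, tens) is a tensor product of the W i: tens v stands for the pure tensor
   v_1 (x) ... (x) v_d. *)
Definition is_tensor_product (K : fieldType) (d : nat) (W : 'I_d -> vectType K)
    (T : vectType K) (tens : (forall i, W i) -> T) :=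
  multilinear tens /\
  forall (U : vectType K) (f : (forall i, W i) -> U), multilinear f ->
    exists! g : 'Hom(T, U), forall v, g (tens v) = f v.

Section TensorRank.
Variables (R : realType) (d : nat) (W : 'I_d -> vectType R[i]).
Variables (T : vectType R[i]) (tens : (forall i, W i) -> T).

Definition tensor_rank (A : T) : nat :=
  least [set r | exists v : 'I_r -> forall i, W i, A = \sum_(k < r) tens (v k)].

Definition rank_le_closure (r : nat) : set T :=
  closure ([set B | (tensor_rank B <= r)%N] : set (euclidean T)).

Definition border_rank (A : T) : nat := least [set r | rank_le_closure r A].

Definition generic_rank : nat := least [set r | rank_le_closure r = setT].

End TensorRank.

Lemma leastP (S : set nat) : S !=set0 -> S (least S) /\ lbound S (least S).
Proof.
case=> n0 Sn0; rewrite /least; case: xgetP => [n _ //|noS]; exfalso.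
have exS : exists n, `[< S n >] by exists n0; apply/asboolP.
case: (ex_minnP exS) => m /asboolP Sm m_min; apply: (noS m); split=> //.
by move=> k Sk; apply: m_min; apply/asboolP.
Qed.

Section WellDefined.
Variables (R : realType) (d : nat) (W : 'I_d -> vectType R[i]).
Variables (T : vectType R[i]) (tens : (forall i, W i) -> T).
Hypotheses (d_gt0 : (0 < d)%N) (T_tensor : is_tensor_product tens).

Let pure_span : exists2 s : seq (forall i, W i),
  size s = \dim {: T} & <<map tens s>>%VS = fullv.
Proof.
pose P n := exists2 s : seq (forall i, W i), size s = n & free (map tens s).
have exP : exists n, `[< P n >].
  by exists 0%N; apply/asboolP; exists [::]; rewrite ?nil_free.
have Pbound n : `[< P n >] -> (n <= \dim {: T})%N.
  case/asboolP=> s <- frs; rewrite -(size_map tens) -(eqP frs).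
  by rewrite dimvS ?subvf.
case: (ex_maxnP exP Pbound) => n /asboolP[s szs frs] n_max.
have memS v : tens v \in <<map tens s>>%VS.
  apply: contraT => vS; have: (n.+1 <= n)%N; last by rewrite ltnn.
  apply: n_max; apply/asboolP; exists (v :: s); first by rewrite /= szs.
  by rewrite /= free_cons vS.
have fullS : <<map tens s>>%VS = fullv.
  have [g [_ g_uniq]] := T_tensor.2 T tens T_tensor.1.
  have pi1 : projv <<map tens s>> = \1%VF.
    transitivity g; last by apply: g_uniq => v; rewrite id_lfunE.
    by apply/esym/g_uniq => v; rewrite projv_id.
  by rewrite -(limg_proj <<map tens s>>) pi1 lim1g.
by exists s => //; rewrite -fullS (eqP frs) size_map.
Qed.

Let scale_pure (c : R[i]) (v : forall i, W i) :
  exists w, c *: tens v = tens w.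
Proof.
pose i0 := Ordinal d_gt0.
pose f (x : W i0) := tens (eqtype.dfwith v x).
have lin : linear f := T_tensor.1 v i0.
have f0 : f 0 = 0.
  by apply: (addrI (f 0)); have := lin 1 0 0; rewrite !scale1r !addr0.
exists (eqtype.dfwith v (c *: v i0)).
have -> : tens v = f (v i0).
  congr tens; apply: functional_extensionality_dep => j.
  by case: eqtype.dfwithP.
by have := lin c (v i0) 0; rewrite f0 !addr0.
Qed.

Let pure_sum (A : T) :
  exists v : 'I_(\dim {: T}) -> forall i, W i, A = \sum_k tens (v k).
Proof.
have [s szs spans] := pure_span.
have : A \in <<map_tuple tens (in_tuple s)>>%VS by rewrite spans memvf.
move/coord_span=> ->; rewrite -szs.
have /choice[w wE] : forall k : 'I_(size s), exists w,
    coord (map_tuple tens (in_tuple s)) k A *: (map tens s)`_k = tens w.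
  move=> k; rewrite (nth_map (fun=> 0)) //; exact: scale_pure.
by exists w; apply: eq_bigr => k _; rewrite -wE.
Qed.

Lemma tensor_rank_spec (A : T) :
  let S := [set r | exists v : 'I_r -> forall i, W i,
                      A = \sum_(k < r) tens (v k)] in
  S (tensor_rank tens A) /\ lbound S (tensor_rank tens A).
Proof. by apply: leastP; exists (\dim {: T}); exact: pure_sum. Qed.

Lemma generic_rank_spec :
  let S := [set r | rank_le_closure tens r = setT] in
  S (generic_rank tens) /\ lbound S (generic_rank tens).
Proof.
apply: leastP; exists (\dim {: T}); apply/seteqP; split=> // A _.
apply: (@subset_closure (euclidean T)); apply: (tensor_rank_spec A).2; exact: pure_sum.
Qed.

Lemma border_rank_spec (A : T) :
  let S := [set r | rank_le_closure tens r A] in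
  S (border_rank tens A) /\ lbound S (border_rank tens A).
Proof.
apply: leastP; exists (tensor_rank tens A).
by apply: (@subset_closure (euclidean T)); rewrite /= leqnn.
Qed.

End WellDefined.

(* Main.v *)
(* Let [sigma_m] be the set of sums of [m] pure tensors, so that the tensors of
   border rank at most [m] form its closure.

   Reaching a tensor of rank [<= r].  Let [A] have border rank [r].  For small [t > 0]
   the parameters of a sum of [r] pure tensors at squared distance at most [t] from [A]
   form a nonempty semialgebraic set.  The lexicographically least element of
   smallest norm is a definable function of [t], and a definable function of one
   real variable is continuous near [0+]: its level sets have finite boundaries, so
   its discontinuities are countably many, and they form a definable set.  This gives
   a path in [sigma_r] ending at [A], which near [A] avoids the closed set of tensors
   of border rank [< r].

   Joining tensors of rank [<= r].  By quantifier elimination over the complex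
   numbers, membership in [sigma_(r-1)] is constant off the zero set of a nonzero
   polynomial [Q].  Since [r] is at most the generic rank, [sigma_(r-1)] is not dense,
   so [Q] vanishes on it.  Take [k] least such that [Q] does not vanish on [sigma_k];
   translating [Q] by the last [k - r] terms of a sum where it is nonzero gives a
   polynomial [h] that vanishes on [sigma_(r-1)] but not at some [B] in [sigma_r].  On
   the complex line joining the parameters of a tensor in [sigma_r] to those of [B],
   [h] has finitely many zeros, and an arc avoids them. *)
Require Import Defs.
From HB Require Import structures.
From mathcomp Require Import all_boot all_order all_algebra.
From mathcomp Require Import complex.
From mathcomp Require ordered_qelim qe_rcf.
From mathcomp Require closed_field.
From mathcomp Require Import all_classical all_reals all_analysis.
From mathcomp Require Import ring lra.

Set Implicit Arguments.
Unset Strict Implicit.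
Unset Printing Implicit Defensive.

Import Order.TTheory GRing.Theory Num.Theory.
Import numFieldNormedType.Exports.
Import VectorInternalTheory.
Local Open Scope classical_set_scope.
Local Open Scope ring_scope.
Local Open Scope complex_scope.

(** * Topology of a complex vector space *)

Section Euclidean.
Variables (R : realType) (T : vectType R[i]).

Definition sqnorm (u : T) : R :=
  \sum_k (complex.Re (v2r u 0 k) ^+ 2 + complex.Im (v2r u 0 k) ^+ 2).

Lemma sqnorm0 : sqnorm 0 = 0.
Proof. by rewrite /sqnorm big1 // => k _; rewrite linear0 mxE /= expr0n addr0. Qed.

Lemma sqnormN (u : T) : sqnorm (- u) = sqnorm u.
Proof.
apply: eq_bigr => k _; rewrite linearN mxE /=.
by case: (v2r u 0 k) => a b /=; rewrite !sqrrN.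
Qed.

Lemma coord_le_sqnorm (u : T) k :
  complex.Re (v2r u 0 k) ^+ 2 + complex.Im (v2r u 0 k) ^+ 2 <= sqnorm u.
Proof.
rewrite /sqnorm (bigD1 k) //= lerDl.
by apply: sumr_ge0 => j _; rewrite addr_ge0 ?sqr_ge0.
Qed.

Lemma normc_ltE (z : R[i]) (e : R) : 0 < e ->
  (`|z| < e%:C) = (complex.Re z ^+ 2 + complex.Im z ^+ 2 < e ^+ 2).
Proof.
move=> e0; rewrite normc_def ltcR -[in LHS](gtr0_norm e0) -sqrtr_sqr.
by rewrite ltr_sqrt // exprn_gt0.
Qed.

Lemma ball_rowP n (x y : 'rV[R[i]^o]_n) (e : R) :
  ball x e%:C y <-> 0 < e /\ forall k,
    complex.Re (x 0 k - y 0 k) ^+ 2 + complex.Im (x 0 k - y 0 k) ^+ 2 < e ^+ 2.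
Proof.
split=> [[]|[e0 xy]].
  rewrite ltcR => e0 xy; split=> // k.
  by have := xy 0 k; rewrite -ball_normE /= normc_ltE.
split=> [|i k]; first by rewrite ltcR.
by rewrite ord1 -ball_normE /= normc_ltE.
Qed.

(** A positive element of [R[i]] is real, so real radii suffice. *)
Lemma nbhs_rowP n (x : 'rV[R[i]^o]_n) (U : set 'rV[R[i]^o]_n) :
  nbhs x U <-> exists2 e : R, 0 < e & ball x e%:C `<=` U.
Proof.
split=> [/nbhs_ballP[[a b] /=]|[e e0 eU]].
  by rewrite ltcE /= => /andP[/eqP -> a0] aU; exists a.
by apply/nbhs_ballP; exists e%:C; first by rewrite /= ltcR.
Qed.

Lemma v2rB (A B : T) k : v2r (A - B) 0 k = v2r A 0 k - v2r B 0 k.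
Proof. by rewrite linearB !mxE. Qed.

Lemma nbhs_euclideanE (A : T) (U : set T) :
  nbhs (A : euclidean T) U <->
  exists2 V : set 'rV[R[i]^o]_(dim T), nbhs (v2r A : 'rV[R[i]^o]_(dim T)) V &
    v2r @^-1` V `<=` U.
Proof.
split.
  case=> V [[Y openY <-] /= YA] YU; exists Y => //.
  exact: open_nbhs_nbhs.
case=> V nV VU.
have nb := @initial_continuous _ _ (v2r : euclidean T -> 'rV[R[i]^o]_(dim T)) A _ nV.
exact: (@filterS _ (nbhs (A : euclidean T)) _ _ _ VU nb).
Qed.

Lemma nbhs_euclideanP (A : T) (U : set T) :
  nbhs (A : euclidean T) U <->
  exists2 e : R, 0 < e & forall B : T, sqnorm (A - B) < e -> U B.
Proof.
split=> [/nbhs_euclideanE[V /nbhs_rowP[e e0 eV] VU]|[e e0 eU]].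
  exists (e ^+ 2) => [|B AB]; first by rewrite exprn_gt0.
  apply: VU; apply: eV; apply/ball_rowP; split=> // k.
  have := le_lt_trans (coord_le_sqnorm (A - B) k) AB; rewrite v2rB.
  exact.
(* Each of the [dim T] squared moduli is then below [e / (dim T + 1)]; the extra 1 keeps their sum
   strictly below [e] and covers dimension zero. *)
pose d := Num.sqrt (e / (dim T).+1%:R).
have d0 : 0 < d by rewrite sqrtr_gt0 divr_gt0.
apply/nbhs_euclideanE; exists (ball (v2r A : 'rV[R[i]^o]_(dim T)) d%:C).
  by apply/nbhs_rowP; exists d.
move=> B /ball_rowP[_ AB]; apply: eU.
apply: (@le_lt_trans _ _ (\sum_(k < dim T) e / (dim T).+1%:R)).
  apply: ler_sum => k _; have := AB k; rewrite v2rB /d sqr_sqrtr; last first.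
    by rewrite divr_ge0 // ltW.
  exact: ltW.
rewrite sumr_const card_ord -[_ *+ _]mulr_natr mulrAC ltr_pdivrMr ?ltr0n //.
by rewrite ltr_pM2l // ltr_nat.
Qed.

Lemma closure_euclideanP (A : T) (S : set T) :
  closure (S : set (euclidean T)) A <->
  forall e : R, 0 < e -> exists2 B, S B & sqnorm (A - B) < e.
Proof.
split=> [clS e e0|apx U /nbhs_euclideanP[e e0 eU]]; last first.
  by have [B SB AB] := apx e e0; exists B; split => //; apply: eU.
have [|B [SB AB]] := clS [set B | sqnorm (A - B) < e]; last by exists B.
by apply/nbhs_euclideanP; exists e.
Qed.

Lemma closure_euclideanPn (A : T) (S : set T) :
  ~ closure (S : set (euclidean T)) A ->
  exists2 e : R, 0 < e & forall B, sqnorm (A - B) < e ->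
    ~ closure (S : set (euclidean T)) B.
Proof.
move=> nA; apply/nbhs_euclideanP.
have : open_nbhs (A : euclidean T) (~` closure (S : set (euclidean T))).
  by split => //; apply: closed_openC; apply: closed_closure.
exact: open_nbhs_nbhs.
Qed.

End Euclidean.

(** * Classes of functions closed under ring operations *)

Section FunctionClasses.
Variables (K : fieldType) (E : Type).

(** The instances below are functions given by terms, univariate polynomial functions and functions
    continuous at a point. A fact about polynomial expressions is proved once and read in each of
    them. *)
Definition subalgebra (PF : (E -> K) -> Prop) :=
  [/\ forall c, PF (fun=> c),
      forall f g, PF f -> PF g -> PF (fun e => f e + g e)
    & forall f g, PF f -> PF g -> PF (fun e => f e * g e)].

Variable PF : (E -> K) -> Prop.

Definition coords_in (U : vectType K) (F : E -> U) :=
  forall k, PF (fun e => v2r (F e) 0 k).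

Hypothesis PFalg : subalgebra PF.

Lemma subalgebra_sum (I : Type) (s : seq I) (f : I -> E -> K) :
  (forall i, PF (f i)) -> PF (fun e => \sum_(i <- s) f i e).
Proof.
have [PFc PFD _] := PFalg; move=> PFf; elim: s => [|i s IHs].
  by under eq_fun do rewrite big_nil.
by under eq_fun do rewrite big_cons; exact: PFD.
Qed.

Lemma coords_in_cst (U : vectType K) (u : U) : coords_in (fun=> u).
Proof. by case: PFalg => PFc _ _ k; exact: PFc. Qed.

Lemma coords_inD (U : vectType K) (F G : E -> U) :
  coords_in F -> coords_in G -> coords_in (fun e => F e + G e).
Proof.
have [_ PFD _] := PFalg; move=> PFF PFG k.
by under eq_fun do rewrite linearD mxE; exact: PFD.
Qed.

Lemma coords_inZ (U : vectType K) (c : E -> K) (F : E -> U) :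
  PF c -> coords_in F -> coords_in (fun e => c e *: F e).
Proof.
have [_ _ PFM] := PFalg; move=> PFF PFG k.
by under eq_fun do rewrite linearZ mxE; exact: PFM.
Qed.

Lemma coords_in_sum (U : vectType K) (I : Type) (s : seq I) (F : I -> E -> U) :
  (forall i, coords_in (F i)) -> coords_in (fun e => \sum_(i <- s) F i e).
Proof.
move=> PFF k; under eq_fun do rewrite linear_sum summxE.
by apply: subalgebra_sum => i; exact: PFF.
Qed.

(** Induction on a bound [m] for the slots that vary with [e]: the last such slot is expanded in a
    basis, its coefficients lie in [PF], and in each summand that slot holds a fixed basis
    vector. *)
Lemma coords_in_multilinear (d : nat) (W : 'I_d -> vectType K)
    (U : vectType K) (f : (forall i, W i) -> U) (v : E -> forall i, W i) :
  multilinear f -> (forall i, coords_in (fun e => v e i)) ->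
  coords_in (fun e => f (v e)).
Proof.
move=> mf.
suff aux m : forall v : E -> forall i, W i,
    (forall i, coords_in (fun e => v e i)) ->
    (exists w : forall i, W i, forall e (i : 'I_d), (m <= i)%N -> v e i = w i) ->
    coords_in (fun e => f (v e)).
  move=> vin; apply: (aux d) => //; exists (fun=> 0) => e i.
  by rewrite leqNgt ltn_ord.
elim: m => [|m IHm] {}v vin [w vw].
  suff -> : (fun e => f (v e)) = fun=> f w by exact: coords_in_cst.
  by apply/funext => e; congr f; apply: functional_extensionality_dep => i; apply: vw.
have [md|dm] := ltnP m d; last first.
  apply: IHm => //; exists w => e i mi.
  by have := leq_ltn_trans (leq_trans dm mi) (ltn_ord i); rewrite ltnn.
pose i0 := Ordinal md; pose b k : W i0 := r2v (delta_mx 0 k).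
have -> : (fun e => f (v e)) = fun e =>
    \sum_k v2r (v e i0) 0 k *: f (eqtype.dfwith (v e) (b k)).
  apply/funext => e.
  pose g := GRing.isLinear.Build _ _ _ _ (fun x : W i0 => f (eqtype.dfwith (v e) x)) (mf (v e) i0).
  pose G : {linear W i0 -> U} := HB.pack (fun x : W i0 => f (eqtype.dfwith (v e) x)) g.
  have -> : f (v e) = G (v e i0).
    congr f; apply: functional_extensionality_dep => j.
    by case: eqtype.dfwithP.
  have {1}-> : v e i0 = \sum_k v2r (v e i0) 0 k *: b k.
    apply: (can_inj v2rK); rewrite linear_sum [LHS]row_sum_delta.
    by apply: eq_bigr => k _; rewrite linearZ /=; rewrite r2vK.
  by rewrite linear_sum; apply: eq_bigr => k _; rewrite linearZ.
apply: coords_in_sum => k; apply: coords_inZ; first exact: vin.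
apply: IHm => [i|].
  have [->|ii0] := eqVneq i i0.
    by under eq_fun do rewrite eqtype.dfwith_in; exact: coords_in_cst.
  by under eq_fun do rewrite eqtype.dfwith_out 1?eq_sym //; exact: vin.
exists (eqtype.dfwith w (b k)) => e i mi; have [->|ii0] := eqVneq i i0.
  by rewrite !eqtype.dfwith_in.
rewrite !eqtype.dfwith_out 1?eq_sym //; apply: vw.
by rewrite ltn_neqAle mi andbT eq_sym; apply: contra ii0 => /eqP im; apply/eqP/val_inj.
Qed.

Lemma rterm_in (t : GRing.term K) (s : E -> seq K) :
  GRing.rterm t -> (forall i, PF (fun e => (s e)`_i)) ->
  PF (fun e => GRing.eval (s e) t).
Proof.
have [PFc PFD PFM] := PFalg; move=> + sin.
elim: t => //=.
- by move=> t1 IH1 t2 IH2 /andP[r1 r2]; apply: PFD; [exact: IH1|exact: IH2].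
- move=> t IHt rt; under eq_fun do rewrite -mulN1r.
  by apply: PFM; [exact: PFc|exact: IHt].
- move=> t IHt n rt; under eq_fun do rewrite -mulr_natr.
  by apply: PFM; [exact: IHt|exact: PFc].
- by move=> t1 IH1 t2 IH2 /andP[r1 r2]; apply: PFM; [exact: IH1|exact: IH2].
- move=> t IHt n rt; elim: n => [|n IHn]; first exact: PFc.
  by under eq_fun do rewrite exprS; apply: PFM => //; exact: IHt.
Qed.

End FunctionClasses.

Definition is_poly (K : fieldType) (f : K -> K) :=
  exists p : {poly K}, forall x, f x = p.[x].

Lemma is_poly_subalgebra (K : fieldType) : subalgebra (@is_poly K).
Proof.
split=> [c|f g [p fp] [q gq]|f g [p fp] [q gq]].
- by exists c%:P => x; rewrite hornerC.
- by exists (p + q) => x; rewrite hornerD fp gq.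
- by exists (p * q) => x; rewrite hornerM fp gq.
Qed.

(** * Semialgebraic sets *)

Section Definable.
Variable R : realType.
Import ordered_qelim.

Definition term_def n (f : seq R -> R) :=
  exists t : GRing.term R, forall e, size e = n -> GRing.eval e t = f e.

(** Only environments of length [n] count, so a quantifier can bind the fresh variable [n] and
    append its value to the list. *)
Definition definable n (P : seq R -> Prop) :=
  exists f : ord.formula R, forall e, size e = n -> (ord.holds e f <-> P e).

Lemma term_def_subalgebra n : subalgebra (term_def n).
Proof.
split=> [c|f g [t tf] [u ug]|f g [t tf] [u ug]].
- by exists (GRing.Const c).
- by exists (GRing.Add t u) => e se /=; rewrite tf ?ug.
- by exists (GRing.Mul t u) => e se /=; rewrite tf ?ug.
Qed.

Lemma term_def_nth n i : term_def n (fun e => e`_i).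
Proof. by exists (GRing.Var R i). Qed.

Lemma definable_ext n (P Q : seq R -> Prop) :
  (forall e, size e = n -> (P e <-> Q e)) -> definable n P -> definable n Q.
Proof. by move=> PQ [f fP]; exists f => e se; rewrite fP ?PQ. Qed.

Lemma definable_le n f g :
  term_def n f -> term_def n g -> definable n (fun e => f e <= g e).
Proof. by move=> [t tf] [u ug]; exists (ord.Le t u) => e se /=; rewrite tf ?ug. Qed.

Lemma definable_lt n f g :
  term_def n f -> term_def n g -> definable n (fun e => f e < g e).
Proof. by move=> [t tf] [u ug]; exists (ord.Lt t u) => e se /=; rewrite tf ?ug. Qed.

Lemma definable_eq n f g :
  term_def n f -> term_def n g -> definable n (fun e => f e = g e).
Proof. by move=> [t tf] [u ug]; exists (ord.Equal t u) => e se /=; rewrite tf ?ug. Qed.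

Lemma definable_and n P Q :
  definable n P -> definable n Q -> definable n (fun e => P e /\ Q e).
Proof. by move=> [f fP] [g gQ]; exists (ord.And f g) => e se /=; rewrite fP ?gQ. Qed.

Lemma definable_imp n P Q :
  definable n P -> definable n Q -> definable n (fun e => P e -> Q e).
Proof. by move=> [f fP] [g gQ]; exists (ord.Implies f g) => e se /=; rewrite fP ?gQ. Qed.

Lemma definable_not n P : definable n P -> definable n (fun e => ~ P e).
Proof. by move=> [f fP]; exists (ord.Not f) => e se /=; rewrite fP. Qed.

Lemma definable_forall_ord n m (P : 'I_m -> seq R -> Prop) :
  (forall i, definable n (P i)) -> definable n (fun e => forall i, P i e).
Proof.
move=> /choice[f fP].
exists (\big[@ord.And R/ord.Bool true]_(i < m) f i) => e se.
have bigP s : ord.holds e (\big[@ord.And R/ord.Bool true]_(i <- s) f i) <->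
    forall i : 'I_m, i \in s -> P i e.
  elim: s => [|i s IHs]; first by rewrite big_nil; split.
  rewrite big_cons /= IHs fP //; split=> [[Pi Ps] j|Ps].
    by rewrite in_cons => /predU1P[->|/Ps].
  by split=> [|j js]; apply: Ps; rewrite in_cons ?eqxx ?js ?orbT.
by rewrite bigP; split=> Ps i => //; apply: Ps; rewrite mem_index_enum.
Qed.

Lemma definable_exists1 n P :
  definable n.+1 P -> definable n (fun e => exists x, P (rcons e x)).
Proof.
move=> [f fP]; exists (ord.Exists n f) => e se /=.
have setE x : set_nth 0 e n x = rcons e x.
  by rewrite -se; elim: (e) => //= y e' ->.
by split=> -[x Px]; exists x; move: Px; rewrite setE fP // size_rcons se.
Qed.

Lemma definable_exists n m P : definable (n + m) P ->
  definable n (fun e => exists s, size s = m /\ P (e ++ s)).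
Proof.
elim: m n P => [|m IHm] n P.
  rewrite addn0; apply: definable_ext => e _; split=> [Pe|[s [/size0nil->]]].
    by exists [::]; rewrite cats0.
  by rewrite cats0.
rewrite -addSnnS => /IHm/definable_exists1; apply: definable_ext => e _.
split=> [[x [s [sm Ps]]]|[s []]].
  by exists (x :: s); rewrite /= sm -cat_rcons.
by case: s => // x s [sm] Ps; exists x, s; rewrite cat_rcons.
Qed.

Lemma definable_forall n m P : definable (n + m) P ->
  definable n (fun e => forall s, size s = m -> P (e ++ s)).
Proof.
move=> /definable_not/definable_exists/definable_not.
apply: definable_ext => e _; split=> [nP s sm|Pe [s [/Pe]]] //.
by apply: contrapT => nPs; apply: nP; exists s.
Qed.

(** The finite unions of points and intervals: the roots of [q] contain all boundary points. In this
    form boundary sets are merged by multiplying polynomials. *)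
Definition tame (P : R -> Prop) := exists2 q : {poly R}, q != 0 &
  forall a b, a <= b -> (forall x, a <= x <= b -> ~~ root q x) -> (P a <-> P b).

Lemma tameM P Q : tame P -> tame Q ->
  [/\ tame (fun x => P x /\ Q x), tame (fun x => P x \/ Q x)
    & tame (fun x => P x -> Q x)].
Proof.
move=> [p p0 Pp] [q q0 Qq]; split; exists (p * q); rewrite ?mulf_neq0 //;
  move=> a b ab nr; have := Pp a b ab; have := Qq a b ab;
  (move=> Qab Pab; have {}Pab : P a <-> P b
     by apply: Pab => x /nr; rewrite rootM negb_or => /andP[]);
  (have {Qab} Qab : Q a <-> Q b
     by apply: Qab => x /nr; rewrite rootM negb_or => /andP[]);
  by rewrite Pab Qab.
Qed.

Lemma tame_cst (b : Prop) : tame (fun=> b).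
Proof. by exists 1; rewrite ?oner_eq0. Qed.

Lemma horner_lt0_norootP (p : {poly R}) a b :
  a <= b -> (forall x, a <= x <= b -> ~~ root p x) -> (p.[a] < 0) = (p.[b] < 0).
Proof.
move=> ab nr.
have pa : p.[a] != 0 by apply: nr; rewrite lexx.
have pb : p.[b] != 0 by apply: nr; rewrite lexx ab.
apply/idP/idP => [pa0|pb0]; rewrite ltNge; apply/negP => p0.
  have [x xab rx] := poly_ivt ab (ltac:(by rewrite ltW) : p.[a] <= 0 <= p.[b]).
  by have := nr x; rewrite rx => /(_ xab).
have [x xab rx] := @poly_ivt _ (- p) a b ab (ltac:(by rewrite !hornerN oppr_le0 oppr_ge0 p0 ltW)).
by have := nr x; rewrite -rootN rx => /(_ xab).
Qed.

Lemma rterm_is_poly t : GRing.rterm t -> is_poly (fun x : R => GRing.eval [:: x] t).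
Proof.
move=> rt; apply: (rterm_in (@is_poly_subalgebra R) rt) => -[|i].
  by exists 'X => x; rewrite hornerX.
by exists 0 => x; rewrite /= nth_nil horner0.
Qed.

Lemma tame_lt0 (f : R -> R) : is_poly f -> tame (fun x => f x < 0).
Proof.
(* The zero polynomial is no valid witness, but then the condition is constant and [1] serves. *)
move=> [p fp]; have [p0|p0] := eqVneq p 0.
  by exists 1; rewrite ?oner_eq0 // => a b _ _; rewrite !fp p0 !horner0.
by exists p => // a b ab nr; rewrite !fp (horner_lt0_norootP ab nr).
Qed.

Lemma tame_eq0 (f : R -> R) : is_poly f -> tame (fun x => f x = 0).
Proof.
move=> [p fp]; have [p0|p0] := eqVneq p 0.
  by exists 1; rewrite ?oner_eq0 // => a b _ _; rewrite !fp p0 !horner0.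
exists p => // a b ab nr; rewrite !fp.
by split=> /rootP r0; [have := nr a|have := nr b]; rewrite r0 lexx ab => /(_ isT).
Qed.

Lemma tame_not P : tame P -> tame (fun x => ~ P x).
Proof. by move=> [q q0 Pq]; exists q => // a b ab nr; rewrite (Pq a b). Qed.

Lemma tame_ext P Q : (forall x, P x <-> Q x) -> tame P -> tame Q.
Proof. by move=> PQ [q q0 Pq]; exists q => // a b; rewrite -!PQ; exact: Pq. Qed.

Lemma is_polyB (f g : R -> R) : is_poly f -> is_poly g -> is_poly (fun x => f x - g x).
Proof. by move=> [p fp] [q gq]; exists (p - q) => x; rewrite hornerD hornerN fp gq. Qed.

Lemma tame_qf (f : ord.formula R) : ord.qf_form f -> ord.rformula f ->
  tame (fun x => ord.holds [:: x] f).
Proof.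
elim: f => //=.
- by move=> b _ _; exact: tame_cst.
- move=> t u _ /andP[/rterm_is_poly pt /rterm_is_poly pu].
  apply: tame_ext (tame_eq0 (is_polyB pt pu)) => x.
  by split=> [/eqP|->]; rewrite ?subrr // subr_eq0 => /eqP.
- move=> t u _ /andP[/rterm_is_poly pt /rterm_is_poly pu].
  by apply: tame_ext (tame_lt0 (is_polyB pt pu)) => x; rewrite subr_lt0.
- move=> t u _ /andP[/rterm_is_poly pt /rterm_is_poly pu].
  apply: tame_ext (tame_not (tame_lt0 (is_polyB pu pt))) => x.
  by rewrite subr_lt0 leNgt; split=> /negP.
- move=> f IHf g IHg /andP[qf qg] /andP[rf rg].
  by case: (tameM (IHf qf rf) (IHg qg rg)).
- move=> f IHf g IHg /andP[qf qg] /andP[rf rg].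
  by case: (tameM (IHf qf rf) (IHg qg rg)).
- move=> f IHf g IHg /andP[qf qg] /andP[rf rg].
  by case: (tameM (IHf qf rf) (IHg qg rg)).
- by move=> f IHf qf rf; exact: tame_not (IHf qf rf).
Qed.

(** Real quantifier elimination leaves a Boolean combination of sign conditions on polynomials in
    one variable. *)
Lemma definable_tame (P : R -> Prop) : definable 1 (fun e => P e`_0) -> tame P.
Proof.
move=> [f fP]; pose w i bc : ord.formula R := qe_rcf.qfr_to_formula (qe_rcf.wproj i bc).
pose g := ord.quantifier_elim w (ord.to_rform f).
have rf := ord.to_rform_rformula f.
have /andP[qg rg] : ord.qf_form g && ord.rformula g.
  exact: (ord.quantifier_elim_wf (@qe_rcf.wf_QE_wproj R)).
apply: tame_ext (tame_qf qg rg) => x.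
have gP := ord.quantifier_elim_rformP (@qe_rcf.wf_QE_wproj R) (@qe_rcf.valid_QE_wproj R) [:: x] rf.
have fx : ord.holds [:: x] (ord.to_rform f) <-> P x.
  by rewrite ord.to_rformP fP.
have hP := ord.qf_evalP [:: x] qg.
by split=> [/hP/gP/fx|/fx/gP/hP].
Qed.

End Definable.

(** * Definable functions of one variable *)

Section EventuallyContinuous.
Variable R : realType.

Lemma poly_near_noroot (q : {poly R}) (t : R) : ~~ root q t ->
  exists2 e : R, 0 < e & forall s, `|t - s| < e -> ~~ root q s.
Proof.
move=> qt; have e0 : 0 < `|q.[t]| by rewrite normr_gt0.
have /cvgrPdist_lt/(_ _ e0)/nbhs_ballP[e /= eg0 eP] := @continuous_horner R q t.
exists e => // s ts; apply: contraTN isT => /rootP qs.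
by have := eP s; rewrite /= qs subr0 ltxx -ball_normE => /(_ ts).
Qed.

Lemma tame_near (P : R -> Prop) q t :
  (forall a b, a <= b -> (forall x, a <= x <= b -> ~~ root q x) -> (P a <-> P b)) ->
  ~~ root q t -> P t -> exists2 e : R, 0 < e & forall s, `|t - s| < e -> P s.
Proof.
move=> qP /poly_near_noroot[e e0 eP] Pt; exists e => // s ts.
have [ts'|st] := leP t s.
  apply/(qP t s ts') => // x /andP[tx xs]; apply: eP.
  by move: ts; rewrite ler0_norm ?subr_le0 // ler0_norm ?subr_le0 //; lra.
apply/(qP s t (ltW st)) => // x /andP[sx xt]; apply: eP.
by move: ts; rewrite gtr0_norm ?subr_gt0 // ger0_norm ?subr_ge0 //; lra.
Qed.

(** The root [0] is divided out with its multiplicity; the cofactor has no root near [0]. *)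
Lemma poly_noroot_right0 (q : {poly R}) : q != 0 ->
  exists2 e : R, 0 < e & forall s, 0 < s < e -> ~~ root q s.
Proof.
move=> q0; have [k [p pn0 qE]] := multiplicity_XsubC q 0.
move: pn0; rewrite q0 /= => /poly_near_noroot[e e0 eP]; exists e => // s /andP[s0 se].
rewrite qE rootM negb_or eP ?sub0r ?normrN ?gtr0_norm //=.
by rewrite rootE horner_exp hornerXsubC subr0 expf_neq0 // gt_eqF.
Qed.

Variables (f : R -> R) (G : R -> R -> Prop).
(** Arbitrary positions [a] and [b] are allowed, since the formulas below apply the graph to several
    pairs of variables. *)
Hypothesis Gdef : forall n a b, (a < n)%N -> (b < n)%N ->
  definable n (fun e => G e`_a e`_b).
Hypothesis GP : forall t u, 0 < t -> (G t u <-> u = f t).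

(** The discontinuities of [f] at positive points, written with [G] and linear inequalities so that
    definability can be read off. *)
Let disc t := 0 < t /\ exists ep, 0 < ep /\ forall eta, 0 < eta ->
  exists s, (0 < s /\ t - eta < s /\ s < t + eta) /\
    exists u v, (G t u /\ G s v) /\ ~ (u - ep < v /\ v < u + ep).

Let term_defB n g h :
  term_def n g -> term_def n h -> term_def n (fun e : seq R => g e - h e).
Proof. by move=> [t tg] [u uh]; exists (GRing.Add t (GRing.Opp u)) => e se /=; rewrite tg ?uh. Qed.

Let term_defD n g h :
  term_def n g -> term_def n h -> term_def n (fun e : seq R => g e + h e).
Proof. by case: (term_def_subalgebra R n) => _ H _; exact: H. Qed.

Let disc_tame : tame disc.
Proof.
have v0 n : term_def n (fun=> 0 : R) by case: (term_def_subalgebra R n).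
have v n i := @term_def_nth R n i.
apply: definable_tame.
(* The variables 0 to 5 stand for [t], [ep], [eta], [s], [u], [v]. *)
pose P6 (e : seq R) := (G e`_0 e`_4 /\ G e`_3 e`_5) /\
  ~ (e`_4 - e`_1 < e`_5 /\ e`_5 < e`_4 + e`_1).
have D6 : definable 6 P6.
  apply: definable_and; first by apply: definable_and; exact: Gdef.
  apply/definable_not/definable_and; apply: definable_lt => //.
    exact: term_defB.
  exact: term_defD.
have /definable_exists1/definable_exists1 D4 := D6.
have D4' : definable 4 (fun e : seq R => (0 < e`_3 /\ e`_0 - e`_2 < e`_3 /\ e`_3 < e`_0 + e`_2)).
  apply: definable_and; first exact: definable_lt.
  apply: definable_and; apply: definable_lt => //.
    exact: term_defB.
  exact: term_defD.
have /definable_exists1 D3 := definable_and D4' D4.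
have D3' : definable 3 (fun e : seq R => 0 < e`_2) by exact: definable_lt.
(* The universal quantifier over [eta] is a negated existential one. *)
have /definable_not/definable_exists1/definable_not D2 := definable_imp D3' D3.
have D2' : definable 2 (fun e : seq R => 0 < e`_1) by exact: definable_lt.
have /definable_exists1 D1 := definable_and D2' D2.
have D1' : definable 1 (fun e : seq R => 0 < e`_0) by exact: definable_lt.
apply: definable_ext (definable_and D1' D1) => -[|t [|]] //= _.
rewrite /disc; split=> -[t0 [ep [ep0 H]]]; split=> //; exists ep; split=> //.
  by move=> eta eta0; apply: contrapT => nP; apply: H; exists eta => /(_ eta0).
by move=> [eta nP]; apply: nP => eta0; exact: H.
Qed.

Let level_tame c :
  tame (fun t => 0 < t /\ exists u, G t u /\ c < u) /\
  tame (fun t => 0 < t /\ exists u, G t u /\ u < c).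
Proof.
have cc n : term_def n (fun=> c) by case: (term_def_subalgebra R n).
have v0 n : term_def n (fun=> 0 : R) by case: (term_def_subalgebra R n).
have v n i := @term_def_nth R n i.
split; apply: definable_tame.
- have D2 : definable 2 (fun e : seq R => G e`_0 e`_1 /\ c < e`_1).
    by apply: definable_and; [exact: Gdef|exact: definable_lt].
  have D1 : definable 1 (fun e : seq R => 0 < e`_0) by exact: definable_lt.
  by apply: definable_ext (definable_and D1 (definable_exists1 D2)) => -[|t [|]].
- have D2 : definable 2 (fun e : seq R => G e`_0 e`_1 /\ e`_1 < c).
    by apply: definable_and; [exact: Gdef|exact: definable_lt].
  have D1 : definable 1 (fun e : seq R => 0 < e`_0) by exact: definable_lt.
  by apply: definable_ext (definable_and D1 (definable_exists1 D2)) => -[|t [|]].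
Qed.

(** Choose rationals [a] and [b] with [f t - ep < a < f t < b < f t + ep]. If [t] is a boundary
    point of neither level set, [a < f < b] persists near [t], against the discontinuity. So [t] is
    a root of [Q a] or [Q b], where [Q c] covers the boundaries of both [f > c] and [f < c]. *)
Let disc_countable :
  exists2 Q : rat -> {poly R}, (forall c, Q c != 0) &
    forall t, disc t -> exists c, root (Q c) t.
Proof.
have /choice[Q QP] : forall c : rat, exists q : {poly R}, [/\ q != 0,
    forall t, 0 < t -> ratr c < f t -> ~~ root q t ->
      exists2 e : R, 0 < e & forall s, `|t - s| < e -> 0 < s -> ratr c < f s
  & forall t, 0 < t -> f t < ratr c -> ~~ root q t ->
      exists2 e : R, 0 < e & forall s, `|t - s| < e -> 0 < s -> f s < ratr c].
  move=> c; have [[p p0 pP] [q q0 qP]] := level_tame (ratr c).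
  exists (p * q); split=> [|t t0 ct|t t0 ct]; rewrite ?mulf_neq0 // rootM negb_or => /andP[pt qt].
    have [|e e0 eP] := tame_near pP pt.
      by split=> //; exists (f t); split=> //; apply/GP.
    by exists e => // s /eP[s0 [u [/GP-> //]]].
  have [|e e0 eP] := tame_near qP qt.
    by split=> //; exists (f t); split=> //; apply/GP.
  by exists e => // s /eP[s0 [u [/GP-> //]]].
exists Q => [c|t [t0 [ep [ep0 dt]]]]; first by case: (QP c).
apply: contrapT => nr.
have nrt c : ~~ root (Q c) t by apply/negP => rt; apply: nr; exists c.
have [|a] := @rat_in_itvoo R (f t - ep) (f t); first by lra.
have [|b] := @rat_in_itvoo R (f t) (f t + ep); first by lra.
rewrite !in_itv /= => /andP[b1 b2] /andP[a1 a2].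
have [_ /(_ t t0 a2 (nrt a))[e1 e10 e1P] _] := QP a.
have [_ _ /(_ t t0 b1 (nrt b))[e2 e20 e2P]] := QP b.
have [|s [[s0 [ts st]] [u [v [[/GP uE /GP vE]]]]]] := dt (Num.min e1 e2).
  by rewrite lt_min e10.
rewrite uE // vE //; apply.
have : `|t - s| < Num.min e1 e2.
  by rewrite ltr_distl; apply/andP; split; lra.
rewrite lt_min => /andP[ts1 ts2].
by have := e1P s ts1 s0; have := e2P s ts2 s0; split; lra.
Qed.

(** The set of discontinuities is tame, so just to the right of [0] it contains everything or
    nothing. The former would make an interval []0, d[] countable, hence of measure zero. *)
Lemma definable_fun_continuous :
  exists2 d : R, 0 < d & forall t, 0 < t < d -> {for t, continuous f}.
Proof.
have [q q0 qP] := disc_tame.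
have [d d0 dP] := poly_noroot_right0 q0; exists d => // t /andP[t0 td].
suff ndisc : ~ disc t.
  apply/cvgrPdist_lt => ep ep0; apply: contrapT => nep; apply: ndisc.
  split=> //; exists ep; split=> // eta eta0; apply: contrapT => nH; apply: nep.
  have m0 : 0 < Num.min eta t by rewrite lt_min eta0.
  apply/nbhs_ballP; exists (Num.min eta t) => //= s.
  rewrite /ball_ /= lt_min => /andP[tse tst].
  have [st1 st2] : t - eta < s /\ s < t + eta.
    by move: tse; rewrite ltr_distl => /andP[]; split; lra.
  have s0 : 0 < s by move: tst; rewrite ltr_distl => /andP[]; lra.
  rewrite ltNge; apply/negP => epts; apply: nH; exists s; split=> //.
  exists (f t), (f s); split; first by split; apply/GP.
  move=> [h1 h2]; move: epts; apply/negP; rewrite -ltNge ltr_distl.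
  by apply/andP; split; lra.
move=> dt.
have dall s : 0 < s < d -> disc s.
  move=> /andP[s0 sd]; have [ts|st] := leP t s.
    apply/(qP t s ts) => // x /andP[tx xs]; apply: dP.
    by rewrite (lt_le_trans t0 tx) (le_lt_trans xs sd).
  apply/(qP s t (ltW st)) => // x /andP[sx xt]; apply: dP.
  by rewrite (lt_le_trans s0 sx) (le_lt_trans xt td).
have [Q Q0 QP] := disc_countable.
have cnt : countable (`]0, d[%classic : set R).
  apply: (@sub_countable _ _ _ (\bigcup_(c in [set: rat]) [set` polyrcf.roots (Q c) 0 d])).
    apply: subset_card_le => s /= /[!in_itv] /= sd; have [c rc] := QP s (dall s sd).
    by exists c => //=; rewrite polyrcf.in_roots rc Q0 in_itv /= sd.
  apply: bigcup_countable => // c _; exact/finite_set_countable/finite_seq.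
have := countable_lebesgue_measure0 cnt.
rewrite lebesgue_measure_itv /= lte_fin d0 => /eqP.
by rewrite -EFinB eqe subr0 gt_eqF.
Qed.

End EventuallyContinuous.

(** * Curve selection *)

(* A polynomial map is one that preserves every class of functions closed under the
   ring operations; this one property yields terms, continuity and univariate
   polynomials along lines. *)
Definition polynomial_map (K : fieldType) (G : seq K -> K) :=
  forall (E : Type) (PF : (E -> K) -> Prop), subalgebra PF ->
  forall s : E -> seq K, (forall i, PF (fun e => (s e)`_i)) ->
  PF (fun e => G (s e)).

Lemma continuous_subalgebra (R : realType) (X : topologicalType) (x : X) :
  subalgebra (fun f : X -> R => continuous_at x f).
Proof.
split=> [c|f g fx gx|f g fx gx]; first exact: cvg_cst.
  exact: continuousD.
exact: continuousM.
Qed.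

Section CurveSelection.
Variables (R : realType) (M : nat) (G : seq R -> R).
Hypothesis polyG : polynomial_map G.

Let nrm (x : seq R) : R := \sum_(i < M) x`_i ^+ 2.
(** Comparing norms first confines the search for a least element to a bounded set; comparing
    coordinates at equal norm makes it unique. *)
Let lexle x y := nrm x <= nrm y /\
  forall i : 'I_M, (nrm x = nrm y /\ forall k : 'I_M, (k < i)%N -> x`_k = y`_k) ->
  x`_i <= y`_i.
Let sel t x := G x <= t /\ forall y, size y = M -> G y <= t -> lexle x y.
Let blk k (e : seq R) := mkseq (fun i => e`_(k + i)) M.

Let blk_def n k i : term_def n (fun e => (blk k e)`_i).
Proof.
have [iM|Mi] := ltnP i M.
  by under eq_fun do rewrite nth_mkseq //; exact: term_def_nth.
under eq_fun do rewrite nth_default ?size_mkseq //.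
by case: (term_def_subalgebra R n).
Qed.

Let nrm_def n k : term_def n (fun e => nrm (blk k e)).
Proof.
have PFalg := term_def_subalgebra R n; have [_ _ PFM] := PFalg.
apply: subalgebra_sum => // i; under eq_fun do rewrite expr2.
by apply: PFM; exact: blk_def.
Qed.

Let lexle_def n k l : definable n (fun e => lexle (blk k e) (blk l e)).
Proof.
apply: definable_and; first by apply: definable_le; exact: nrm_def.
apply: definable_forall_ord => i; apply: definable_imp; last first.
  by apply: definable_le; exact: blk_def.
apply: definable_and; first by apply: definable_eq; exact: nrm_def.
apply: definable_forall_ord => j; have [ji|ij] := ltnP j i.
  apply: definable_ext (definable_eq (blk_def n k j) (blk_def n l j)) => e _.
  by split=> // /(_ isT).
exists (ordered_qelim.ord.Bool true) => e _; split=> //.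
Qed.

Let sel_def n a k : (a < n)%N -> (k + M <= n)%N ->
  definable n (fun e => sel e`_a (blk k e)).
Proof.
move=> an kn; apply: definable_and.
  apply: definable_le; last exact: term_def_nth.
  by apply: (polyG (term_def_subalgebra R n)) => i; exact: blk_def.
(* The competitor [y] in [sel] occupies the fresh variables from [n] to [n + M - 1]. *)
have GD : definable (n + M) (fun e => G (blk n e) <= e`_a).
  apply: definable_le; last exact: term_def_nth.
  by apply: (polyG (term_def_subalgebra R (n + M))) => i; exact: blk_def.
have := definable_forall (definable_imp GD (lexle_def (n + M) k n)).
apply: definable_ext => e en.
have ea y : (e ++ y)`_a = e`_a by rewrite nth_cat en an.
have ek y : blk k (e ++ y) = blk k e.
  apply/eq_in_map => i; rewrite mem_iota /= add0n => iM.
  by rewrite nth_cat en (leq_trans _ kn) // ltn_add2l.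
have ey y : size y = M -> blk n (e ++ y) = y.
  move=> yM; apply: (@eq_from_nth _ 0); rewrite size_mkseq // => i iM.
  by rewrite nth_mkseq // nth_cat en ltnNge leq_addr /= addKn.
split=> H y yM; first by have := H y yM; rewrite ea ek ey.
by rewrite ea ek ey //; exact: H.
Qed.

Let sel_coord_def i n a b : (a < n)%N -> (b < n)%N ->
  definable n (fun e => exists x, size x = M /\ (sel e`_a x /\ x`_i = e`_b)).
Proof.
move=> an bn.
have := definable_exists (definable_and (sel_def (ltn_addr M an) (leqnn (n + M)))
   (definable_eq (blk_def (n + M) n i) (term_def_nth R (n + M) b))).
apply: definable_ext => e en.
have ea y c : (c < n)%N -> (e ++ y)`_c = e`_c by move=> cn; rewrite nth_cat en cn.
have ey y : size y = M -> blk n (e ++ y) = y.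
  move=> yM; apply: (@eq_from_nth _ 0); rewrite size_mkseq // => j jM.
  by rewrite nth_mkseq // nth_cat en ltnNge leq_addr /= addKn.
by split=> -[x [xM [H1 H2]]]; exists x; split=> //; move: H1 H2; rewrite !ea // ey.
Qed.

Let sel_unique t x y : size x = M -> size y = M -> sel t x -> sel t y -> x = y.
Proof.
move=> xM yM [Gx xmin] [Gy ymin].
have [nxy lxy] := xmin y yM Gy; have [nyx lyx] := ymin x xM Gx.
have nE : nrm x = nrm y by apply/eqP; rewrite eq_le nxy.
apply: (@eq_from_nth _ 0); rewrite ?xM // => i.
elim/ltn_ind: i => i IHi iM; apply/eqP; rewrite eq_le.
apply/andP; split; [apply: (lxy (Ordinal iM))|apply: (lyx (Ordinal iM))];
  by split=> // k /= ki; rewrite IHi.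
Qed.

Let sq (v : 'rV[R]_M) : seq R := [tuple v 0 i | i < M].

Let sqE v (i : 'I_M) : (sq v)`_i = v 0 i.
Proof. by rewrite -tnth_nth tnth_mktuple. Qed.

Let sq_surj x : size x = M -> exists v, sq v = x.
Proof.
move=> xM; exists (\row_i x`_i); apply: (@eq_from_nth _ 0).
  by rewrite size_tuple.
by rewrite size_tuple => i iM; rewrite -[ i ]/(nat_of_ord (Ordinal iM)) sqE mxE.
Qed.

Let sq_continuous i : continuous (fun v => (sq v)`_i).
Proof.
have [iM|Mi] := ltnP i M; last first.
  under eq_fun do rewrite nth_default ?size_tuple //.
  exact: cst_continuous.
rewrite -[ i ]/(nat_of_ord (Ordinal iM)); under eq_fun do rewrite sqE.
exact: coord_continuous.
Qed.

Let sqG_continuous : continuous (G \o sq).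
Proof.
move=> v; apply: (polyG (continuous_subalgebra R v)) => i; exact: sq_continuous.
Qed.

Let nrm_continuous : continuous (nrm \o sq).
Proof.
move=> v; have calg := continuous_subalgebra R v; have [_ _ cM] := calg.
apply: (subalgebra_sum calg) => i; under eq_fun do rewrite expr2.
by apply: cM; exact: sq_continuous.
Qed.

(** Keeping all minimisers, and not just one, allows minimising the next function among them. *)
Let compact_argmin (f : 'rV[R]_M -> R) (K : set 'rV[R]_M) :
  continuous f -> compact K -> K !=set0 ->
  let K' := [set v | K v /\ forall w, K w -> f v <= f w] in
  compact K' /\ K' !=set0.
Proof.
move=> fc cK K0.
have [v /set_mem Kv vmin] := EVT_min_rV K0 cK (continuous_subspaceT fc).
have vmin' w : K w -> f v <= f w by move=> Kw; apply: vmin; exact/mem_set.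
split; last by exists v.
have -> : [set v | K v /\ forall w, K w -> f v <= f w] =
    K `&` f @^-1` [set y | y <= f v].
  apply/seteqP; split=> w [Kw wP]; split=> //; first exact: wP.
  by move=> u /vmin'; exact: le_trans.
apply: compact_closedI => //.
by move/continuous_closedP: fc; apply; exact: closed_le.
Qed.

(** The norm is minimised first, then the coordinates one after the other, each on the compact set
    of minimisers left by the previous step. *)
Let sel_exists t : (exists2 x, size x = M & G x <= t) ->
  exists2 x, size x = M & sel t x.
Proof.
case=> x0 /sq_surj[v0 <-] Gv0.
(* [K] may be unbounded; only its points of norm at most that of the known point [v0] can be
   minimal, and they form a compact set. *)
pose K := [set v | G (sq v) <= t].
pose K0 := K `&` [set v | nrm (sq v) <= nrm (sq v0)].
have cK0 : compact K0.
  have n0 : 0 <= nrm (sq v0) by apply: sumr_ge0 => i _; exact: sqr_ge0.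
  pose c := Num.sqrt (nrm (sq v0)).
  apply: (@subclosed_compact _ _ [set v : 'rV[R]_M | forall i, v ord0 i \in `[- c, c]]).
  - apply: closedI.
      have /continuous_closedP/(_ [set y | y <= t]) := sqG_continuous.
      by apply; exact: closed_le.
    have /continuous_closedP/(_ [set y | y <= nrm (sq v0)]) := nrm_continuous.
    by apply; exact: closed_le.
  - apply: (@rV_compact _ _ (fun=> `[- c, c]%classic)) => _.
    exact: segment_compact.
  - move=> v [_ /= vn] i; rewrite in_itv /= -ler_norml -sqrtr_sqr.
    apply: ler_wsqrtr; apply: le_trans vn.
    rewrite /nrm (bigD1 i) //= sqE lerDl.
    by apply: sumr_ge0 => j _; exact: sqr_ge0.
have [cK1 K1n0] := compact_argmin nrm_continuous cK0 (ex_intro _ v0 (conj Gv0 (lexx _))).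
set K1 := [set v | _] in cK1 K1n0.
have K1min v w : K1 v -> K w -> nrm (sq v) <= nrm (sq w).
  move=> [[_ /= vv0] vmin] Kw.
  have [wv0|/ltW wv0] := leP (nrm (sq w)) (nrm (sq v0)); first exact: vmin.
  exact: le_trans wv0.
have K1K v w : K1 v -> K w -> nrm (sq v) = nrm (sq w) -> K1 w.
  move=> [[Kv /= vv0] vmin] Kw vw; split; first by split; rewrite //= -vw.
  by move=> u /vmin; rewrite vw.
(* [L] is what remains after minimising the first [m] coordinates. By the last clause it contains
   every point of [K1] that agrees with one of its points in these coordinates, so minimising the
   next coordinate over [L] respects the lexicographic order on [K1]. *)
have /(_ M)[L [_ [v Lv] LP _]] : forall m, exists L : set 'rV[R]_M,
    [/\ compact L, L !=set0,
      forall v, L v -> K1 v /\ forall w, K1 w -> forall i : 'I_M, (i < m)%N ->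
        (forall k : 'I_M, (k < i)%N -> v 0 k = w 0 k) -> v 0 i <= w 0 i
    & forall v w, L v -> K1 w ->
        (forall k : 'I_M, (k < m)%N -> v 0 k = w 0 k) -> L w].
  elim=> [|m [L [cL L0 LP LK]]].
    by exists K1; split=> //; split=> // w Kw i; rewrite ltn0.
  have [mM|Mm] := ltnP m M; last first.
    exists L; split=> // [v Lv|v w Lv Kw vw]; last first.
      by apply: LK Lv Kw _ => k km; apply: vw; rewrite ltnW.
    have [Kv vP] := LP v Lv; split=> // w Kw i _; apply: vP => //.
    exact: leq_trans (ltn_ord i) Mm.
  pose j := Ordinal mM.
  have [cL' L'0] := compact_argmin (@coord_continuous R 1 M 0 j) cL L0.
  exists [set v | L v /\ forall w, L w -> v 0 j <= w 0 j]; split=> //.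
    move=> v [Lv vmin]; have [Kv vP] := LP v Lv; split=> // w Kw i.
    rewrite ltnS leq_eqVlt => /predU1P[im|im]; last exact: vP.
    have -> : i = j by exact/val_inj.
    by move=> vw; apply: vmin; apply: LK Lv Kw _.
  move=> v w [Lv vmin] Kw vw; split.
    by apply: LK Lv Kw _ => k km; apply: vw; rewrite ltnW.
  by move=> u Lu; rewrite -(vw j) //; exact: vmin.
exists (sq v); first by rewrite size_tuple.
have [K1v vP] := LP v Lv; have [[Kv _] _] := K1v; split=> // y /sq_surj[w <-] Kw.
split=> [|i [nvw vw]]; first exact: K1min.
rewrite !sqE; apply: vP => // [|k ki]; first exact: K1K nvw.
by rewrite -!sqE vw.
Qed.

(** By uniqueness of the selected point each of its coordinates is a function of [t] with definable
    graph, hence continuous near [0] on the right. The least of the finitely many thresholds serves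
    all coordinates. *)
Theorem curve_selection :
  (forall e, 0 < e -> exists2 x, size x = M & G x < e) ->
  exists2 d : R, 0 < d & exists p : R -> seq R,
    forall t, 0 < t < d -> [/\ size (p t) = M, G (p t) <= t
      & forall i, {for t, continuous (fun t => (p t)`_i)}].
Proof.
move=> infG.
have /choice[p pP] : forall t, exists x, size x = M /\ (0 < t -> sel t x).
  move=> t; have [t0|t0] := ltP 0 t; last by exists (nseq M 0); rewrite size_nseq.
  have [x xM /ltW Gx] := infG t t0.
  by have [y yM yt] := sel_exists (ex_intro2 _ _ x xM Gx); exists y.
have cont (i : 'I_M) : exists2 d : R, 0 < d &
    forall t, 0 < t < d -> {for t, continuous (fun t => (p t)`_i)}.
  apply: (@definable_fun_continuous R _ (fun t u => exists x, size x = M /\ (sel t x /\ x`_i = u))).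
    by move=> n a b; exact: sel_coord_def.
  move=> t u t0; have [pM /(_ t0) pt] := pP t; split=> [[x [xM [xt <-]]]|->].
    by rewrite (sel_unique xM pM xt pt).
  by exists (p t).
have [d d0 dP] : exists2 d : R, 0 < d &
    forall (i : 'I_M) t, 0 < t < d -> {for t, continuous (fun t => (p t)`_i)}.
  have /choice[dd ddP] : forall i : 'I_M, exists d : R, 0 < d /\
      forall t, 0 < t < d -> {for t, continuous (fun t => (p t)`_i)}.
    by move=> i; have [d d0 dP] := cont i; exists d.
  exists (\big[Num.min/1]_(i < M) dd i).
    apply: (big_ind (fun x : R => 0 < x)) => [//|x y x0 y0|i _]; last by case: (ddP i).
    by rewrite lt_min x0.
  move=> i t /andP[t0 td]; apply: (ddP i).2; rewrite t0 /=.
  by apply: lt_le_trans td _; exact: bigmin_le_cond.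
exists d => //; exists p => t td; have [t0 _] := andP td.
have [pM /(_ t0)[Gp _]] := pP t; split=> // i.
have [iM|Mi] := ltnP i M; first exact: (dP (Ordinal iM)).
rewrite (_ : (fun t => _) = fun=> 0); first exact: cst_continuous.
by apply/funext => s; rewrite nth_default // (pP s).1.
Qed.

End CurveSelection.

(** * Paths *)

Section ComplexClasses.
Variables (R : realType) (E : Type) (PF : (E -> R) -> Prop).

(** Carries a class of real functions over to complex values, so that tensors can be treated as
    polynomial expressions in real parameters. *)
Definition re_im_in (f : E -> R[i]) :=
  PF (fun e => complex.Re (f e)) /\ PF (fun e => complex.Im (f e)).

Hypothesis PFalg : subalgebra PF.

Lemma subalgebraN f : PF f -> PF (fun e => - f e).
Proof.
case: PFalg => PFc _ PFM PFf; under eq_fun do rewrite -mulN1r.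
exact: PFM.
Qed.

Lemma re_im_subalgebra : subalgebra re_im_in.
Proof.
have [PFc PFD PFM] := PFalg.
have ReM (x y : R[i]) : complex.Re (x * y) =
  complex.Re x * complex.Re y - complex.Im x * complex.Im y by case: x y => a b [].
have ImM (x y : R[i]) : complex.Im (x * y) =
  complex.Re x * complex.Im y + complex.Im x * complex.Re y by case: x y => a b [].
have ReD (x y : R[i]) : complex.Re (x + y) = complex.Re x + complex.Re y by case: x y => a b [].
have ImD (x y : R[i]) : complex.Im (x + y) = complex.Im x + complex.Im y by case: x y => a b [].
split=> [c|f g [Rf If] [Rg Ig]|f g [Rf If] [Rg Ig]]; split; try exact: PFc.
- by under eq_fun do rewrite ReD; exact: PFD.
- by under eq_fun do rewrite ImD; exact: PFD.
- under eq_fun do rewrite ReM; apply: (PFD _ (fun e => - _)); first exact: PFM.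
  by apply: subalgebraN; exact: PFM.
- by under eq_fun do rewrite ImM; apply: PFD; exact: PFM.
Qed.

Lemma sqnorm_in (T : vectType R[i]) (F : E -> T) (A : T) :
  coords_in re_im_in F -> PF (fun e => sqnorm (F e - A)).
Proof.
move=> FP; have [PFc PFD PFM] := PFalg.
have FA : coords_in re_im_in (fun e => F e - A).
  by apply: (coords_inD re_im_subalgebra) => //; exact: (coords_in_cst re_im_subalgebra).
rewrite /sqnorm; apply: subalgebra_sum => // k; have [RF IF] := FA k.
by apply: PFD; under eq_fun do rewrite expr2; exact: PFM.
Qed.

End ComplexClasses.

(** * Continuity into the Euclidean topology, coordinate by coordinate *)

Section EuclideanContinuity.
Variables (R : realType) (X : topologicalType) (T : vectType R[i]).

Definition ccontinuous_at (x : X) := re_im_in (fun f : X -> R => continuous_at x f).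

Lemma ccontinuous_subalgebra (x : X) : subalgebra (ccontinuous_at x).
Proof. exact/re_im_subalgebra/continuous_subalgebra. Qed.

(** Real and imaginary parts of coordinates do not increase distance; conversely the squared
    distance to [g x] is a polynomial in them that vanishes at [x]. *)
Lemma euclidean_continuousP (x : X) (g : X -> T) :
  continuous_at x (g : X -> euclidean T) <-> coords_in (ccontinuous_at x) g.
Proof.
split=> [gx k|gx].
  have sub (f : T -> R) : (forall u v, (f u - f v) ^+ 2 <= sqnorm (u - v)) ->
      continuous_at x (fun y => f (g y)).
    move=> fP; apply/cvgrPdist_lt => e e0.
    have : nbhs (g x : euclidean T) [set v | sqnorm (g x - v) < e ^+ 2].
      by apply/nbhs_euclideanP; exists (e ^+ 2) => //; rewrite exprn_gt0.
    move=> /gx; apply: (@filterS _ (nbhs x)) => y /= gxy.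
    have := le_lt_trans (fP (g x) (g y)) gxy.
    by rewrite -[ltLHS]real_normK ?num_real // ltr_pXn2r ?nnegrE // ltW.
  split; apply: (sub (fun u => _ (v2r u 0 k))) => u v;
    apply: le_trans (coord_le_sqnorm (u - v) k); rewrite v2rB;
    case: (v2r u 0 k) (v2r v 0 k) => [a b] [c d] /=.
    by rewrite lerDl sqr_ge0.
  by rewrite lerDr sqr_ge0.
move=> U /nbhs_euclideanP[e e0 eU].
have := sqnorm_in (continuous_subalgebra R x) (g x) gx.
move=> /cvgrPdist_lt/(_ e e0); apply: (@filterS _ (nbhs x)) => y /=.
rewrite subrr sqnorm0 sub0r normrN => gxy; apply: eU.
by rewrite -sqnormN opprB; exact: le_lt_trans (ler_norm _) gxy.
Qed.

End EuclideanContinuity.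

(** * Joining points inside a set *)

Section Paths.
Variables (R : realType) (T : vectType R[i]) (S : set T).

(** Paths are continuous on all of [R], which avoids subspace topologies; [clamp] makes them rest at
    their ends. *)
Definition joined (x y : T) := exists g : R -> T,
  [/\ continuous (g : R -> euclidean T), g 0 = x, g 1 = y
    & forall t : R, 0 <= t <= 1 -> S (g t)].

Definition clamp (t : R) : R := Num.max 0 (Num.min 1 t).

Lemma clamp_continuous : continuous clamp.
Proof.
move=> t; apply: continuous_max; first exact: cst_continuous.
by apply: continuous_min; [exact: cst_continuous|exact: cvg_id].
Qed.

Lemma clamp_le0 (t : R) : t <= 0 -> clamp t = 0.
Proof. by move=> t0; rewrite /clamp (min_idPr (le_trans t0 ler01)) (max_idPl t0). Qed.

Lemma clamp_ge1 (t : R) : 1 <= t -> clamp t = 1.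
Proof. by move=> t1; rewrite /clamp (min_idPl t1) (max_idPr ler01). Qed.

Lemma clamp_itv (t : R) : 0 <= clamp t <= 1.
Proof. by rewrite /clamp le_max lexx /= ge_max ler01 ge_min lexx. Qed.

Lemma affine_continuous (a b : R) : continuous (fun t : R => a * t + b).
Proof.
move=> t; have [cst_in addP mulP] := continuous_subalgebra R t.
by apply: addP => //; apply: mulP => //; exact: cvg_id.
Qed.

Lemma continuous_clamp_affine (X : topologicalType) (f : R -> X) (a b : R) :
  continuous f -> continuous (fun t => f (clamp (a * t + b))).
Proof.
move=> fc t.
have cc : {for t, continuous (clamp \o (fun t : R => a * t + b))}.
  by apply: continuous_comp; [exact: affine_continuous|exact: clamp_continuous].
exact: (@continuous_comp _ _ _ _ f t cc (fc _)).
Qed.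

Lemma joined_sym x y : joined x y -> joined y x.
Proof.
case=> g [gc g0 g1 gS]; exists (fun t => g (-1 * t + 1)); split.
- by move=> t; apply: (continuous_comp (@affine_continuous _ _ _)); exact: gc.
- by rewrite mulr0 add0r.
- by rewrite mulr1 addNr.
- by move=> t /andP[t0 t1]; apply: gS; lra.
Qed.

(* The concatenation is [f (clamp 2t) + g (clamp (2t - 1)) - y]: on each half of
   the interval one of the two paths rests at [y]. *)
Lemma joined_trans y x z : joined x y -> joined y z -> joined x z.
Proof.
move=> [f [fc f0 f1 fS]] [g [gc g0 g1 gS]].
exists (fun t => f (clamp (2 * t + 0)) + g (clamp (2 * t + -1)) + - y); split.
- move=> t; apply/euclidean_continuousP.
  have calg := ccontinuous_subalgebra R t.
  apply: (coords_inD calg); last exact: coords_in_cst.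
  apply: (coords_inD calg); apply/euclidean_continuousP.
    exact: continuous_clamp_affine.
  exact: continuous_clamp_affine.
- by rewrite !clamp_le0 ?f0 ?g0 ?addrK //; lra.
- by rewrite !clamp_ge1 ?f1 ?g1 1?addrAC ?subrr ?add0r //; lra.
- move=> t /andP[t0 t1]; have [th|/ltW th] := leP t (2^-1).
    rewrite (@clamp_le0 (2 * t + -1)) ?g0 ?addrK; last by lra.
    exact/fS/clamp_itv.
  rewrite (@clamp_ge1 (2 * t + 0)) ?f1 1?addrAC ?subrr ?add0r; last by lra.
  exact/gS/clamp_itv.
Qed.

Lemma joined_path_connected :
  (forall x y, S x -> S y -> joined x y) ->
  path_connected R (S : set (euclidean T)).
Proof.
move=> jS x y Sx Sy; have [g [gc g0 g1 gS]] := jS x y Sx Sy.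
by exists g; split=> //; exact: continuous_subspaceT.
Qed.

End Paths.

(** * Images of complex polynomial maps *)

Section AlgebraicImage.
Variable K : numClosedFieldType.

Lemma poly_nonroot (p : {poly K}) (u : nat -> K) (N : nat) :
  p != 0 -> injective u -> exists2 n, (N <= n)%N & ~~ root p (u n).
Proof.
move=> p0 uI; apply: contrapT => nP.
suff : (size p < size p)%N by rewrite ltnn.
rewrite -{1}(size_iota N (size p)) -(size_map u); apply: max_poly_roots => //.
  apply/allP => x /mapP[n]; rewrite mem_iota => /andP[Nn _] ->.
  by apply/negPn/negP => ru; apply: nP; exists n.
by rewrite map_inj_uniq ?iota_uniq.
Qed.

Definition seq_line (n : nat) (a b : seq K) (x : K) : seq K :=
  mkseq (fun i => a`_i + x * (b`_i - a`_i)) n.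

Lemma seq_line0 n a b : size a = n -> seq_line n a b 0 = a.
Proof.
move=> an; apply: (@eq_from_nth _ 0); rewrite size_mkseq // => i lin.
by rewrite nth_mkseq // mul0r addr0.
Qed.

Lemma seq_line1 n a b : size b = n -> seq_line n a b 1 = b.
Proof.
move=> bn; apply: (@eq_from_nth _ 0); rewrite size_mkseq // => i lin.
by rewrite nth_mkseq // mul1r addrC subrK.
Qed.

Lemma rterm_line (t : GRing.term K) (n : nat) (a b : seq K) : GRing.rterm t ->
  is_poly (fun x => GRing.eval (seq_line n a b x) t).
Proof.
move=> rt; apply: (rterm_in (@is_poly_subalgebra K) rt) => i.
have [lin|ni] := ltnP i n.
  under eq_fun do rewrite nth_mkseq //.
  exists ((a`_i)%:P + 'X * (b`_i - a`_i)%:P) => x.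
  by rewrite hornerD hornerC hornerM hornerX hornerC.
by under eq_fun do rewrite nth_default ?size_mkseq //; exists 0 => x; rewrite horner0.
Qed.

(** The truth value of [P] does not vary on the nonempty Zariski open set where [t] is nonzero;
    which value it takes there is left open. *)
Definition generic_truth n (P : seq K -> Prop) := exists t : GRing.term K,
  [/\ GRing.rterm t, exists2 e, size e = n & GRing.eval e t != 0
    & forall e e', size e = n -> size e' = n ->
        GRing.eval e t != 0 -> GRing.eval e' t != 0 -> (P e <-> P e')].

(** The product of the two polynomials works. It is nonzero somewhere because, on the line through a
    nonzero point of each, both become nonzero univariate polynomials. *)
Lemma generic_truth2 n P Q (op : Prop -> Prop -> Prop) :
  (forall A B C D, (A <-> B) -> (C <-> D) -> (op A C <-> op B D)) ->
  generic_truth n P -> generic_truth n Q -> generic_truth n (fun e => op (P e) (Q e)).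
Proof.
move=> opP [t [rt [a an ta] tP]] [u [ru [b bn ub] uQ]].
exists (GRing.Mul t u); split=> /=; first by rewrite rt.
  have [p pE] := rterm_line n a b rt; have [q qE] := rterm_line n a b ru.
  have p0 : p != 0.
    by apply: contraNneq ta => p0; rewrite -(seq_line0 b an) pE p0 horner0.
  have q0 : q != 0.
    by apply: contraNneq ub => q0; rewrite -(seq_line1 a bn) qE q0 horner0.
  have [k _] := poly_nonroot 0 (mulf_neq0 p0 q0) (mulrIn (oner_neq0 K)).
  rewrite rootE hornerM -pE -qE => pq0.
  by exists (seq_line n a b k%:R) => //; rewrite size_mkseq.
move=> e e' en e'n; rewrite !mulf_eq0 !negb_or => /andP[et eu] /andP[e't e'u].
by apply: opP; [exact: tP|exact: uQ].
Qed.

Lemma generic_truth_ext n P Q : (forall e, P e <-> Q e) ->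
  generic_truth n P -> generic_truth n Q.
Proof.
move=> PQ [t [rt t0 tP]]; exists t; split=> // e e' en e'n et e't.
by rewrite -!PQ; exact: tP.
Qed.

Lemma generic_truth_cst n (P : Prop) : generic_truth n (fun=> P).
Proof.
exists (GRing.NatConst K 1); split=> //=; exists (nseq n 0); rewrite ?size_nseq //.
Qed.

Lemma generic_truth_eq0 n t : GRing.rterm t ->
  generic_truth n (fun e => GRing.eval e t = 0).
Proof.
move=> rt; have [[e en te]|nt] := pselect (exists2 e, size e = n & GRing.eval e t != 0).
  exists t; split=> //; first by exists e.
  by move=> ? ? _ _ /eqP ? /eqP ?.
have t0 e : size e = n -> GRing.eval e t = 0.
  by move=> en; apply/eqP; apply/negPn/negP => te; apply: nt; exists e.
have [u [ru u0 _]] := generic_truth_cst n True.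
by exists u; split=> // e e' en e'n _ _; rewrite !t0.
Qed.

Lemma generic_truth_qf n (f : GRing.formula K) : GRing.qf_form f ->
  GRing.rformula f -> generic_truth n (fun e => GRing.holds e f).
Proof.
elim: f => //=.
- by move=> b _ _; exact: generic_truth_cst.
- move=> t u _ /andP[rt ru].
  have rtu : GRing.rterm (GRing.Add t (GRing.Opp u)) by rewrite /= rt.
  apply: generic_truth_ext (generic_truth_eq0 n rtu) => e /=.
  by split=> [/eqP|->]; rewrite ?subrr // subr_eq0 => /eqP.
- move=> f IHf g IHg /andP[qf qg] /andP[rf rg].
  by apply: generic_truth2 (IHf qf rf) (IHg qg rg) => A B C D -> ->.
- move=> f IHf g IHg /andP[qf qg] /andP[rf rg].
  by apply: generic_truth2 (IHf qf rf) (IHg qg rg) => A B C D -> ->.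
- move=> f IHf g IHg /andP[qf qg] /andP[rf rg].
  by apply: (generic_truth2 (op := fun A B => A -> B)) (IHf qf rf) (IHg qg rg) => A B C D -> ->.
- move=> f IHf qf rf.
  by apply: (generic_truth2 (op := fun A B => ~ A)) (IHf qf rf) (IHf qf rf) => A B C D -> _.
Qed.

(** Quantifier elimination over an algebraically closed field leaves a Boolean combination of
    polynomial equations. *)
Lemma generic_truth_holds n (f : GRing.formula K) :
  generic_truth n (fun e => GRing.holds e f).
Proof.
pose g := GRing.quantifier_elim (@closed_field.ClosedFieldQE.ex_elim K) (GRing.to_rform f).
have rf := GRing.to_rform_rformula f.
have wf := @closed_field.ClosedFieldQE.wf_ex_elim K.
have /andP[qg rg] : GRing.qf_form g && GRing.rformula g.
  exact: GRing.quantifier_elim_wf.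
apply: generic_truth_ext (generic_truth_qf n qg rg) => e.
have ok := closed_field.ClosedFieldQE.holds_ex_elim (@solve_monicpoly K).
have gP := GRing.quantifier_elim_rformP wf ok e rf.
have hP := GRing.qf_evalP e qg.
have fe := GRing.to_rformP e f.
by split=> [/hP/gP/fe|/fe/gP/hP].
Qed.

Lemma holds_exists_iota n m (f : GRing.formula K) e : size e = n ->
  GRing.holds e (foldr GRing.Exists f (iota n m)) <->
  exists s, size s = m /\ GRing.holds (e ++ s) f.
Proof.
elim: m n e => [|m IHm] n e en /=.
  by split=> [fe|[s [/size0nil->]]]; rewrite ?cats0 //; exists [::]; rewrite cats0.
have setE x : set_nth 0 e n x = rcons e x.
  by rewrite -en; elim: (e) => //= y e' ->.
split=> [[x]|[[|x s] [] //= [sm]]].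
  rewrite setE IHm ?size_rcons ?en // => -[s [sm fs]].
  by exists (x :: s); rewrite /= sm -cat_rcons.
rewrite -cat_rcons => fs; exists x; rewrite setE IHm ?size_rcons ?en //.
by exists s.
Qed.

(* By elimination, the image is constructible. *)
Lemma generic_truth_image n m (F : 'I_n -> seq K -> K) :
  (forall k, polynomial_map (F k)) ->
  generic_truth n (fun e => exists s, size s = m /\ forall k, F k s = e`_k).
Proof.
move=> polyF; pose blk (e : seq K) := mkseq (fun i => e`_(n + i)) m.
pose term_fun (f : seq K -> K) := exists t : GRing.term K, forall e, GRing.eval e t = f e.
have talg : subalgebra term_fun.
  split=> [c|f g [t tf] [u ug]|f g [t tf] [u ug]].
  - by exists (GRing.Const c).
  - by exists (GRing.Add t u) => e /=; rewrite tf ug.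
  - by exists (GRing.Mul t u) => e /=; rewrite tf ug.
have /choice[t tE] : forall k, term_fun (fun e => F k (blk e)).
  move=> k; apply: (polyF k _ _ talg) => i; have [im|mi] := ltnP i m.
    by under eq_fun do rewrite nth_mkseq //; exists (GRing.Var K (n + i)).
  by under eq_fun do rewrite nth_default ?size_mkseq //; case: talg.
pose f := \big[@GRing.And K/GRing.Bool true]_(k < n) GRing.Equal (t k) (GRing.Var K k).
have fP e : GRing.holds e f <-> forall k, F k (blk e) = e`_k.
  have bigP (s : seq 'I_n) :
      GRing.holds e (\big[@GRing.And K/GRing.Bool true]_(k <- s)
        GRing.Equal (t k) (GRing.Var K k)) <->
      forall k, k \in s -> F k (blk e) = e`_k.
    elim: s => [|i s IHs]; first by rewrite big_nil; split.
    rewrite big_cons /= IHs tE; split=> [[Pi Ps] j|Ps].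
      by rewrite in_cons => /predU1P[->|/Ps].
    by split=> [|j js]; apply: Ps; rewrite in_cons ?eqxx ?js ?orbT.
  by rewrite bigP; split=> Ps i => //; apply: Ps; rewrite mem_index_enum.
have [u [ru u0 uP]] := generic_truth_holds n (foldr GRing.Exists f (iota n m)).
have imP e : size e = n -> GRing.holds e (foldr GRing.Exists f (iota n m)) <->
    exists s, size s = m /\ forall k, F k s = e`_k.
  move=> en; rewrite (holds_exists_iota m f en).
  have bE s : size s = m -> blk (e ++ s) = s.
    move=> sm; apply: (@eq_from_nth _ 0); rewrite size_mkseq // => i im.
    by rewrite nth_mkseq // nth_cat en ltnNge leq_addr /= addKn.
  split=> -[s [sm sP]]; exists s; split=> //.
    by move=> k; have := (fP _).1 sP k; rewrite bE // nth_cat en ltn_ord.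
  by apply/fP => k; rewrite bE // nth_cat en ltn_ord.
exists u; split=> // e e' en e'n ue ue'.
by rewrite -!imP //; exact: uP.
Qed.

End AlgebraicImage.

(** * Sums of pure tensors *)

Section SumsOfPureTensors.
Variables (R : realType) (d : nat) (W : 'I_d -> vectType R[i]).
Variables (T : vectType R[i]) (tens : (forall i, W i) -> T).
Hypotheses (d_gt0 : (0 < d)%N) (T_tensor : is_tensor_product tens).

Definition sums_of (m : nat) : set T :=
  [set A | exists v : 'I_m -> forall i, W i, A = \sum_(k < m) tens (v k)].

Lemma sums_ofP m A : sums_of m A <->
  exists2 l : seq (forall i, W i), size l = m & A = \sum_(v <- l) tens v.
Proof.
split=> [[v ->]|[l lm ->]].
  exists [seq v k | k <- enum 'I_m]; first by rewrite size_map size_enum_ord.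
  by rewrite big_map big_enum.
exists (fun k => nth (fun=> 0) l k).
by rewrite (big_nth (fun=> 0)) big_mkord lm.
Qed.

Lemma sums_ofD m n A B : sums_of m A -> sums_of n B -> sums_of (m + n) (A + B).
Proof.
move=> /sums_ofP[l lm ->] /sums_ofP[l' ln ->]; apply/sums_ofP.
by exists (l ++ l'); rewrite ?size_cat ?lm ?ln ?big_cat.
Qed.

(** Since [d > 0] there is a slot in which linearity makes the pure tensor of zero vectors vanish,
    so sums can be padded with zero terms. *)
Lemma sums_of0 m : sums_of m 0.
Proof.
have t0 : tens (fun=> 0) = 0.
  pose i0 := Ordinal d_gt0.
  have lin := T_tensor.1 (fun=> 0) i0.
  have vE : eqtype.dfwith (fun i => 0 : W i) (0 : W i0) = fun=> 0.
    by apply: functional_extensionality_dep => j; case: eqtype.dfwithP.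
  have := lin 1 0 0; rewrite !scale1r addr0 vE => tt.
  by apply: (addrI (tens (fun=> 0))); rewrite addr0 -tt.
by exists (fun _ _ => 0); rewrite big1.
Qed.

Lemma sums_of_le m n : (m <= n)%N -> sums_of m `<=` sums_of n.
Proof.
move=> mn A Am; rewrite -(subnKC mn) -(addr0 A).
by apply: sums_ofD => //; exact: sums_of0.
Qed.

Lemma rank_le_closureE m :
  rank_le_closure tens m = closure (sums_of m : set (euclidean T)).
Proof.
rewrite /rank_le_closure.
suff -> : [set B | (tensor_rank tens B <= m)%N] = sums_of m by [].
apply/seteqP; split=> A /=.
  move=> Am; have [Ar _] := tensor_rank_spec d_gt0 T_tensor A.
  exact: sums_of_le Am _ Ar.
by have [_ Ar] := tensor_rank_spec d_gt0 T_tensor A; exact: Ar.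
Qed.

Lemma rank_le_closure_le m n :
  (m <= n)%N -> rank_le_closure tens m `<=` rank_le_closure tens n.
Proof.
move=> mn; rewrite !rank_le_closureE.
exact: (@closure_subset (euclidean T) _ _ (sums_of_le mn)).
Qed.

Lemma border_rankP r A : (0 < r)%N -> border_rank tens A = r <->
  rank_le_closure tens r A /\ ~ rank_le_closure tens r.-1 A.
Proof.
move=> r0; have [/= bA minA] := border_rank_spec tens A; split.
  move=> br; rewrite br in bA minA; split=> // /minA.
  by rewrite leEnat leqNgt prednK // leqnn.
move=> [rA nrA]; apply/eqP; rewrite eqn_leq (minA _ rA : (_ <= _)%N) /=.
rewrite leqNgt; apply/negP => br; apply: nrA.
by apply: rank_le_closure_le bA; rewrite -ltnS prednK.
Qed.

Local Notation tensor_index m := ('I_m * {i : 'I_d & 'I_(dim (W i))})%type.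

(** The list holds the coordinates of all vectors in [m] pure tensors, in the order of [enum_rank];
    missing entries are read as 0. *)
Definition decode (m : nat) (s : seq R[i]) (k : 'I_m) (i : 'I_d) : W i :=
  r2v (\row_j s`_(enum_rank ((k, Tagged (fun i => 'I_(dim (W i))) j) : tensor_index m))).

Definition tensor_map (m : nat) (s : seq R[i]) : T :=
  \sum_(k < m) tens (decode s k).

Lemma tensor_mapP m A : sums_of m A <->
  exists2 s, size s = #|{: tensor_index m}| & tensor_map m s = A.
Proof.
split=> [[v ->]|[s _ <-]]; last by exists (decode s).
pose c (x : tensor_index m) := v2r (v x.1 (tag x.2)) 0 (tagged x.2).
exists [seq c x | x : tensor_index m]; first by rewrite size_image.
apply: eq_bigr => k _; congr tens; apply: functional_extensionality_dep => i.
apply: (can_inj v2rK); rewrite r2vK; apply/rowP => j.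
by rewrite mxE nth_image enum_rankK.
Qed.

Lemma tensor_map_in m (E : Type) (PF : (E -> R[i]) -> Prop) (s : E -> seq R[i]) :
  subalgebra PF -> (forall j, PF (fun e => (s e)`_j)) ->
  coords_in PF (fun e => tensor_map m (s e)).
Proof.
move=> PFalg sP; apply: coords_in_sum => // k.
apply: (coords_in_multilinear PFalg T_tensor.1) => i j.
by under eq_fun do rewrite r2vK mxE; exact: sP.
Qed.

Lemma sums_of_total A : exists m, sums_of m A.
Proof. by have [? _] := tensor_rank_spec d_gt0 T_tensor A; exists (tensor_rank tens A). Qed.

(** The first hypothesis says that [h] is polynomial. On the line from [A] to [x] it is a nonzero
    univariate polynomial, and among the parameters [1 / (n + 1)], which tend to [A], only finitely
    many are roots. *)
Lemma dense_nonzero (h : T -> R[i]) (x A : T) :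
  (forall E (PF : (E -> R[i]) -> Prop) F, subalgebra PF -> coords_in PF F -> PF (h \o F)) ->
  h x != 0 -> closure ([set y | h y != 0] : set (euclidean T)) A.
Proof.
move=> polyh hx; apply/closure_euclideanP => e e0.
have palg := @is_poly_subalgebra R[i].
have [|p pE] := polyh _ _ (fun z => A + z *: (x - A)) palg.
  apply: (coords_inD palg); first exact: coords_in_cst.
  by apply: (coords_inZ palg); [exists 'X => z; rewrite hornerX|exact: coords_in_cst].
have p0 : p != 0.
  apply: contraNneq hx => p0; have := pE 1.
  by rewrite p0 horner0 /= scale1r addrC subrK => ->.
pose u (n : nat) : R[i] := (n.+1%:R^-1)%:C.
have uI : injective u.
  by move=> n m /(congr1 (@complex.Re R)) /= /invr_inj/eqP; rewrite eqr_nat eqSS => /eqP.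
(* From this index on, the squared distance to [A] is below [e]. *)
have [n nN] := poly_nonroot (Num.truncn (sqnorm (x - A) / e)).+1 p0 uI.
rewrite rootE -pE => hn; exists (A + u n *: (x - A)) => //.
rewrite opprD addNKr sqnormN.
have -> : sqnorm (u n *: (x - A)) = n.+1%:R^-1 ^+ 2 * sqnorm (x - A).
  rewrite /sqnorm mulr_sumr; apply: eq_bigr => k _.
  rewrite linearZ mxE; case: (v2r _ 0 k) => a b; rewrite /u /=; ring.
have n1 : sqnorm (x - A) / e < n.+1%:R.
  by rewrite (lt_le_trans (truncnS_gt _)) // ler_nat ltnW // ltnS.
rewrite expr2 -mulrA ltr_pdivrMl ?ltr0n // ltr_pdivrMl ?ltr0n //.
rewrite ltr_pdivrMr // in n1; apply: lt_le_trans n1 _.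
by rewrite mulrA ler_pM2r // ler_peMl // ler1n.
Qed.

Lemma separating_polynomial r : (0 < r)%N -> (r <= generic_rank tens)%N ->
  exists h : T -> R[i],
  [/\ forall E (PF : (E -> R[i]) -> Prop) F,
        subalgebra PF -> coords_in PF F -> PF (h \o F),
      forall x, sums_of r.-1 x -> h x = 0
    & exists2 x, sums_of r x & h x != 0].
Proof.
move=> r0 rg; pose crd (u : T) : seq R[i] := [tuple v2r u 0 k | k < dim T].
have crdE u (k : 'I_(dim T)) : (crd u)`_k = v2r u 0 k.
  by rewrite -tnth_nth tnth_mktuple.
have polyF (k : 'I_(dim T)) : polynomial_map (fun s => v2r (tensor_map r.-1 s) 0 k).
  by move=> E PF PFalg s sP; exact: tensor_map_in.
have [t [rt [e0 e0T te0] tP]] :=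
  generic_truth_image #|{: tensor_index r.-1}| polyF.
pose h0 u := GRing.eval (crd u) t.
have polyh0 E (PF : (E -> R[i]) -> Prop) F : subalgebra PF -> coords_in PF F -> PF (h0 \o F).
  move=> PFalg PFF; apply: (rterm_in PFalg rt) => i.
  have [iT|Ti] := ltnP i (dim T).
    by rewrite -[ i ]/(nat_of_ord (Ordinal iT)); under eq_fun do rewrite crdE; exact: PFF.
  by under eq_fun do rewrite nth_default ?size_tuple //; case: PFalg.
pose u0 : T := r2v (\row_k e0`_k).
have u0E : crd u0 = e0.
  apply: (@eq_from_nth _ 0) => [|i]; rewrite size_tuple // => iT.
  by rewrite -[ i ]/(nat_of_ord (Ordinal iT)) crdE r2vK mxE.
have hu0 : h0 u0 != 0 by rewrite /h0 u0E.
pose im e := exists s, size s = #|{: tensor_index r.-1}| /\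
   forall k, v2r (tensor_map r.-1 s) 0 k = e`_k.
have imP u : im (crd u) <-> sums_of r.-1 u.
  rewrite tensor_mapP; split=> [[s [sm sE]]|[s sm <-]]; exists s => //.
    by apply: (can_inj v2rK); apply/rowP => k; rewrite sE crdE.
  by split=> // k; rewrite crdE.
(* If membership in the image were the generic value, every point with [h0] nonzero would be a sum
   of [r - 1] pure tensors; these points are dense, so the generic rank would be less than [r]. *)
have [/imP u0r|nu0] := pselect (im (crd u0)).
  have : rank_le_closure tens r.-1 = setT.
    rewrite rank_le_closureE; apply/seteqP; split=> // A _.
    apply: (@closure_subset (euclidean T) _ _ _ _ (dense_nonzero polyh0 hu0)).
    move=> x hx; apply/imP.
    by apply/(tP (crd u0) (crd x)); rewrite ?size_tuple //; exact/imP.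
  have [_ mg] := generic_rank_spec d_gt0 T_tensor.
  by move=> /mg; rewrite leEnat => /(leq_trans rg); rewrite leqNgt prednK // leqnn.
have h0_0 x : sums_of r.-1 x -> h0 x = 0.
  move=> /imP xr; apply/eqP/negPn/negP => hx; apply: nu0.
  by apply/(tP (crd u0) (crd x)); rewrite ?size_tuple.
pose nz k := `[< exists2 u, sums_of k u & h0 u != 0 >].
have exnz : exists k, nz k.
  by have [k uk] := sums_of_total u0; exists k; apply/asboolP; exists u0.
case: (ex_minnP exnz) => k /asboolP[u /sums_ofP[l lk uE] hu] kmin.
have rk : (r <= k)%N.
  rewrite leqNgt; apply/negP => kr; case/negP: hu; apply/eqP; apply: h0_0.
  apply: (@sums_of_le k); first by rewrite -ltnS prednK.
  by apply/sums_ofP; exists l.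
(* For [w] a sum of [r - 1] terms, [w + y] is a sum of [k - 1] terms, where [h0] vanishes by
   minimality of [k]; adding [y] to the first [r] terms gives back [u]. *)
pose y := \sum_(v <- drop r l) tens v.
have ky : sums_of (k - r) y by apply/sums_ofP; exists (drop r l); rewrite ?size_drop ?lk.
exists (fun w => h0 (w + y)); split=> [E PF F PFalg PFF|w wr|].
- apply: (polyh0 _ _ (fun e => F e + y)) => //.
  by apply: coords_inD => //; exact: coords_in_cst.
- apply/eqP/negPn/negP => hw.
  have : nz (r.-1 + (k - r))%N by apply/asboolP; exists (w + y) => //; exact: sums_ofD.
  move=> /kmin; rewrite -[leqLHS](subnKC rk) -{1}(prednK r0) addSn.
  by rewrite ltnn.
- exists (\sum_(v <- take r l) tens v).
    by apply/sums_ofP; exists (take r l); rewrite // size_takel // lk.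
  by rewrite /y -big_cat cat_take_drop -uE.
Qed.

End SumsOfPureTensors.

(** * Paths of constant border rank *)

(* Each point other than [0] and [1] lies on the arc [s + i c s (1 - s)] for at most
   one value of [c]. *)
Lemma arc_avoiding_roots (R : realType) (q : {poly R[i]}) : q.[1] != 0 ->
  exists c : R, forall s : R, 0 < s <= 1 -> q.[s +i* (c * (s * (1 - s)))] != 0.
Proof.
move=> q1; have q0 : q != 0 by apply: contraNneq q1 => ->; rewrite horner0.
have [rs qE] := closed_field_poly_normal q.
(* [bad] lists, for each root off the lines of real part 0 and 1, the only slope whose arc meets it;
   the other roots contribute the default value 0. The slope [c] exceeds all of them. *)
pose bad := [seq complex.Im z / (complex.Re z * (1 - complex.Re z)) | z <- rs].
pose c := 1 + \sum_(x <- bad) `|x|.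
have cbad : c \notin bad.
  apply/negP => cb; suff : c < c by rewrite ltxx.
  apply: (@le_lt_trans _ _ (\sum_(x <- bad) `|x|)); last by rewrite ltrDr.
  rewrite (le_trans (ler_norm c)) // (big_rem c) //= lerDl.
  by apply: sumr_ge0 => x _.
exists c => s /andP[s0 s1]; apply/negP => /eqP qs.
have sn1 : s != 1.
  by apply: contraNneq q1 => s1'; apply/eqP; move: qs; rewrite s1' subrr !mulr0.
have : s +i* (c * (s * (1 - s))) \in rs.
  have lq : lead_coef q != 0 by rewrite lead_coef_eq0.
  rewrite -root_prod_XsubC -(rootZ _ _ lq) -qE.
  exact/rootP.
move=> /(map_f (fun z => complex.Im z / (complex.Re z * (1 - complex.Re z)))) /=.
rewrite mulfK; first by rewrite (negPf cbad).
by rewrite mulf_neq0 ?gt_eqF // subr_gt0 lt_neqAle sn1.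
Qed.

Section BorderRankPaths.
Variables (R : realType) (d : nat) (W : 'I_d -> vectType R[i]).
Variables (T : vectType R[i]) (tens : (forall i, W i) -> T) (r : nat).
Hypotheses (d_gt0 : (0 < d)%N) (T_tensor : is_tensor_product tens) (r_gt0 : (0 < r)%N).

Let S : set T := [set A | border_rank tens A = r].
Local Notation N := #|{: 'I_r * {i : 'I_d & 'I_(dim (W i))}}|.
Local Notation tmap := (tensor_map tens r).

(** A polynomial function is continuous, so its real and imaginary parts also vanish on the
    closure. *)
Lemma zero_on_closure (h : T -> R[i]) (B : set T) (A : T) :
  (forall E (PF : (E -> R[i]) -> Prop) F, subalgebra PF -> coords_in PF F -> PF (h \o F)) ->
  (forall x, B x -> h x = 0) -> closure (B : set (euclidean T)) A -> h A = 0.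
Proof.
move=> polyh hB clA.
have idc : coords_in (ccontinuous_at (A : euclidean T)) (fun y : euclidean T => y : T).
  by apply/euclidean_continuousP; exact: cvg_id.
have [cRe cIm] := polyh _ _ _ (ccontinuous_subalgebra R (A : euclidean T)) idc.
have zero (f : R[i] -> R) : f 0 = 0 ->
    continuous_at (A : euclidean T) (fun y : euclidean T => f (h y)) -> f (h A) = 0.
  move=> f0 fc; apply/eqP/negPn/negP => fA.
  have e0 : 0 < `|f (h A)| by rewrite normr_gt0.
  move/cvgrPdist_lt/(_ _ e0) : fc => /clA[y [/hB hy]] /=.
  by rewrite hy f0 subr0 ltxx.
have R0 := zero (@complex.Re R) erefl cRe; have I0 := zero (@complex.Im R) erefl cIm.
by case: (h A) R0 I0 => a b /= -> ->.
Qed.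

Lemma closure_tensor_map s : rank_le_closure tens r (tmap s).
Proof.
rewrite rank_le_closureE //; apply: (@subset_closure (euclidean T)).
by exists (decode W s).
Qed.

(** Past its start the arc stays where [h] is nonzero, hence outside the closure of the sums of
    [r - 1] terms. At the start [h] may vanish, but there the border rank is [r] by hypothesis. *)
Lemma joined_line (h : T -> R[i]) (p a : seq R[i]) :
  (forall E (PF : (E -> R[i]) -> Prop) F, subalgebra PF -> coords_in PF F -> PF (h \o F)) ->
  (forall x, sums_of tens r.-1 x -> h x = 0) ->
  size p = N -> size a = N -> S (tmap p) -> h (tmap a) != 0 ->
  joined S (tmap p) (tmap a).
Proof.
move=> polyh h0 pN aN Sp ha; pose F z := tmap (seq_line N p a z).
have lineP E (PF : (E -> R[i]) -> Prop) (z : E -> R[i]) : subalgebra PF -> PF z ->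
    coords_in PF (fun e => F (z e)).
  move=> PFalg zP; apply: tensor_map_in => // j; have [PFc PFD PFM] := PFalg.
  have [jN|Nj] := ltnP j N; last first.
    by under eq_fun do rewrite nth_default ?size_mkseq //; exact: PFc.
  by under eq_fun do rewrite nth_mkseq //; exact: (PFD _ _ (PFc _) (PFM z _ zP (PFc _))).
have [|q qE] := polyh _ _ _ (@is_poly_subalgebra R[i]) (lineP _ _ id (@is_poly_subalgebra _) _).
  by exists 'X => z; rewrite hornerX.
have [|c cP] := @arc_avoiding_roots R q; first by rewrite -qE /= /F seq_line1.
pose arc (s : R) : R[i] := s +i* (c * (s * (1 - s))).
exists (fun s => F (arc s)); split.
- move=> s; apply/euclidean_continuousP; apply: lineP (ccontinuous_subalgebra R s) _.
  have [cc cD cM] := continuous_subalgebra R s.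
  split=> /=; first exact: cvg_id.
  have sN : continuous_at s (fun t : R => 1 - t).
    apply: (cD (fun=> 1) (fun t => - t) (cc 1)).
    by apply: subalgebraN (continuous_subalgebra R s) _ _; exact: cvg_id.
  exact: (cM _ _ (cc c) (cM _ _ cvg_id sN)).
- by rewrite /arc mul0r mulr0 /F seq_line0.
- by rewrite /arc subrr !mulr0 /F seq_line1.
move=> s /andP[s0 s1]; have [s0'|s0'] := ltP 0 s; last first.
  have -> : s = 0 by apply/eqP; rewrite eq_le s0 s0'.
  by rewrite /arc mul0r mulr0 /F seq_line0.
apply/border_rankP => //; split; first exact: closure_tensor_map.
rewrite rank_le_closureE // => /(zero_on_closure polyh h0) hF.
by have := cP s; rewrite s0' s1 => /(_ isT); rewrite -qE /= hF eqxx.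
Qed.

(** Curve selection runs over the reals: the first [N] entries are real parts, the next [N]
    imaginary parts. *)
Definition complexify (s : seq R) : seq R[i] := mkseq (fun j => s`_j +i* s`_(N + j)) N.

Lemma complexify_surj (s : seq R[i]) : size s = N ->
  exists2 x, size x = (N + N)%N & complexify x = s.
Proof.
move=> sN; exists (map (@complex.Re R) s ++ map (@complex.Im R) s).
  by rewrite size_cat !size_map sN.
apply: (@eq_from_nth _ 0); rewrite size_mkseq // => j jN.
rewrite nth_mkseq // !nth_cat size_map sN jN ltnNge leq_addr /= addKn.
by rewrite !(nth_map 0) ?sN //; case: (s`_j).
Qed.

Lemma tensor_map_complexify_in (E : Type) (PF : (E -> R) -> Prop) (x : E -> seq R) :
  subalgebra PF -> (forall j, PF (fun e => (x e)`_j)) ->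
  coords_in (re_im_in PF) (fun e => tmap (complexify (x e))).
Proof.
move=> PFalg xP; apply: tensor_map_in => //; first exact: re_im_subalgebra.
move=> j; have [jN|Nj] := ltnP j N.
  by under eq_fun do rewrite nth_mkseq //; split; exact: xP.
under eq_fun do rewrite nth_default ?size_mkseq //.
by case: (re_im_subalgebra PFalg).
Qed.

(** Curve selection is applied to the squared distance from [A], as a real polynomial in the
    parameters. *)
Lemma joined_tensor_map (A : T) : S A ->
  exists2 p, size p = N & S (tmap p) /\ joined S A (tmap p).
Proof.
move=> SA; have [clA nclA] := (border_rankP d_gt0 T_tensor A r_gt0).1 SA.
rewrite rank_le_closureE // in nclA.
have [e e0 eP] := closure_euclideanPn nclA.
have inS s : sqnorm (tmap s - A) < e -> S (tmap s).
  move=> sA; apply/border_rankP => //; split; first exact: closure_tensor_map.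
  by rewrite rank_le_closureE //; apply: eP; rewrite -sqnormN opprB.
pose G x := sqnorm (tmap (complexify x) - A).
have polyG : polynomial_map G.
  by move=> E PF PFalg x xP; apply: sqnorm_in => //; exact: tensor_map_complexify_in.
have infG e' : 0 < e' -> exists2 x, size x = (N + N)%N & G x < e'.
  move=> e'0; move: clA; rewrite rank_le_closureE // => /closure_euclideanP/(_ _ e'0)[B].
  move=> /tensor_mapP[s /complexify_surj[x xN <-] <-] AB.
  by exists x; rewrite // /G -sqnormN opprB.
have [d0 d00 [x xP]] := curve_selection polyG infG.
(* Below [d0] the curve is defined and continuous; below [e] its points avoid border rank less than
   [r]. *)
pose d1 := Num.min (d0 / 2) (e / 2).
have [d10 d1d d1e] : [/\ 0 < d1, d1 < d0 & d1 < e].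
  by split; rewrite /d1 ?lt_min ?gt_min; lra.
(* The parameters may diverge as [t] tends to 0, but the tensors tend to [A], because the squared
   distance is at most [t]. *)
pose g (t : R) : T := if 0 < t then tmap (complexify (x t)) else A.
have gc t : t < d0 -> continuous_at t (g : R -> euclidean T).
  move=> td; have [t0|t0|<-] := ltgtP 0 t.
  - have [_ _ xc] := xP t (introT andP (conj t0 td)).
    have : continuous_at t ((fun s => tmap (complexify (x s))) : R -> euclidean T).
      apply/euclidean_continuousP; apply: tensor_map_complexify_in => //.
      exact: continuous_subalgebra.
    rewrite /continuous_at /g t0; apply: cvg_trans; apply: near_eq_cvg.
    by near=> s; rewrite ifT //; near: s; exact: lt_nbhsr.
  - have gtA : g t = A by rewrite /g ltNge (ltW t0).
    have : continuous_at t ((fun=> A) : R -> euclidean T) by exact: cst_continuous.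
    rewrite /continuous_at gtA; apply: cvg_trans; apply: near_eq_cvg.
    near=> s; rewrite /g ifF //; apply/negbTE; rewrite -leNgt ltW //; near: s.
    exact: lt_nbhsl.
  - move=> U /=; rewrite {1}/g ltxx => /nbhs_euclideanP[e1 e10 e1U].
    apply/nbhs_ballP; exists (Num.min e1 d0); first by rewrite /= lt_min e10.
    move=> s; rewrite /ball /= sub0r normrN lt_min => /andP[se sd].
    apply: e1U; rewrite /g; case: ifPn => s0; last by rewrite subrr sqnorm0.
    rewrite gtr0_norm // in se sd.
    have [_ Gs _] := xP s (introT andP (conj s0 sd)).
    by rewrite -sqnormN opprB; exact: le_lt_trans Gs se.
have gS t : 0 <= t <= d1 -> S (g t).
  move=> /andP[t0 td]; rewrite /g; case: ifPn => // t0'.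
  have [|_ Gt _] := xP t; first by rewrite t0' (le_lt_trans td).
  by apply: inS; apply: le_lt_trans Gt _; exact: le_lt_trans td d1e.
exists (complexify (x d1)); first by rewrite size_mkseq.
split; first by have := gS d1; rewrite /g d10 lexx ltW // => /(_ isT).
exists (fun t => g (d1 * clamp t)); split.
- move=> t; have [c0 c1] := andP (clamp_itv t).
  have cd : d1 * clamp t < d0.
    by apply: le_lt_trans d1d; rewrite ler_piMr // ltW.
  have cc : {for t, continuous (fun t => d1 * clamp t)}.
    have [cst_in _ cM] := continuous_subalgebra R t.
    by apply: cM; [exact: cst_in|exact: clamp_continuous].
  exact: (@continuous_comp _ _ (euclidean T) _ (g : R -> euclidean T) t cc (gc _ cd)).
- by rewrite clamp_le0 // mulr0 /g ltxx.
- by rewrite clamp_ge1 // mulr1 /g d10.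
- move=> t _; have /andP[c0 c1] := clamp_itv t.
  apply: gS; rewrite mulr_ge0 ?ler_piMr //; exact: ltW.
Unshelve. all: by end_near. Qed.

End BorderRankPaths.

Theorem corollary3p2 (R : realType) (d : nat) (W : 'I_d -> vectType R[i])
    (T : vectType R[i]) (tens : (forall i, W i) -> T) (r : nat)
    (d_gt0 : (0 < d)%N)
    (dimW : forall i, (2 <= \dim {: W i})%N)
    (T_tensor : is_tensor_product tens)
    (r_gt0 : (0 < r)%N)
    (r_le : (r <= generic_rank tens)%N) :
  path_connected R ([set A | border_rank tens A = r] : set (euclidean T)).
Proof.
have [h [polyh h0 [_ /tensor_mapP[a aN <-] ha]]] :=
  separating_polynomial d_gt0 T_tensor r_gt0 r_le.
apply: joined_path_connected => A B rA rB.
(* Every tensor of border rank [r] is joined to the same point, the one where [h] is nonzero. *)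
have toa C : border_rank tens C = r ->
    joined [set A | border_rank tens A = r] C (tensor_map tens r a).
  move=> /(joined_tensor_map d_gt0 T_tensor r_gt0)[p pN [rp Cp]].
  exact: joined_trans Cp (joined_line d_gt0 T_tensor r_gt0 polyh h0 pN aN rp ha).
exact: joined_trans (toa A rA) (joined_sym (toa B rB)).
Qed.
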